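(* Let $w\ge 4$ and let $C=(C_1,C_2)$ be an equitable $2$-partition of the Johnson graph $J(2w,w)$ whose quotient matrix has $\lambda_2(2w,w)=(w-2)^2-2$ as an eigenvalue. If $w\ge 7$, then $C$ is equivalent to one of the partitions $P_1,P_2,P_3,P_4$ defined below. If $w\in\{4,5,6\}$, then, with the cells ordered so that the quotient matrix $\begin{pmatrix} a& b\\ c& d\end{pmatrix}$ satisfies $b\ge c$, the quotient matrix of $C$ is one of $$\begin{pmatrix} w^2-3w+2 & 3w-2\\ w & w^2-w\end{pmatrix},\quad \begin{pmatrix} w^2-2w & 2w\\ 2w-2 & w^2-2w+2\end{pmatrix},\quad \begin{pmatrix} w^2-3w & 3w\\ w-2 & w^2-w+2\end{pmatrix}.$$
   Context: The Johnson graph $J(n,w)$ has as vertices the binary vectors $x=(x_1,\dots,x_n)$ of length $n$ with exactly $w$ ones; two vertices are adjacent iff they have exactly $w-1$ common ones. Its eigenvalues are $\lambda_i(n,w)=(w-i)(n-w-i)-i$, $i=0,\dots,w$. A $2$-partition $(C_1,C_2)$ of the vertex set into two nonempty cells is equitable with quotient matrix $S=(s_{ij})$ if every vertex of $C_i$ has exactly $s_{ij}$ neighbours in $C_j$. Two functions $f_1,f_2$ on the vertices of $J(n,w)$ are equivalent if there is a permutation $\pi\in S_n$ of coordinates with $f_1(x)=f_2(\pi x)$ for all $x$. Two equitable $2$-partitions $(C_1,C_2)$ and $(C_1',C_2')$ are equivalent if the characteristic function $\chi_{C_1}$ is equivalent to $\chi_{C_1'}$ or to $\chi_{C_2'}$.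 The partitions $P_k=(C_1,C_2)$ of $J(2w,w)$, with $C_2$ the complement of $C_1$, are: $P_1$: $C_1=\{x: (x_1,\dots,x_5)\in B_1\}$ with $B_1=\{10000,11000,10100,00011,01111,00111,01011,11100\}$ (vectors written as strings); $P_2$: $C_1=\{x: x_1+x_2\in\{0,2\}\}$; $P_3$: $C_1=\{x:(x_1,\dots,x_5)\in B_3\}$ with $B_3=\{00000,00100,00010,00001,10100,01010,00101,00011,11111,11011,11101,11110,01011,10101,11010,11100\}$; $P_4$: $C_1=\{x:(x_1,x_2,x_3)\in\{000,111\}\}$. *)

(* Defs.v *)
From HB Require Import structures.
From mathcomp Require Import all_boot all_order all_fingroup all_algebra.
Set Implicit Arguments. Unset Strict Implicit. Unset Printing Implicit Defensive.
Import Order.TTheory GRing.Theory Num.Theory.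

(* Binary vectors of length n are finite functions 'I_n -> bool;
   coordinate x_{k+1} of the paper is [coord x k] (0-based). *)
Definition bvec (n : nat) := {ffun 'I_n -> bool}.

Definition wt n (x : bvec n) : nat := #|[set i | x i]|.

Definition Vtx n w : {set bvec n} := [set x | wt x == w].

Definition adjJ n w (x y : bvec n) : bool :=
  [&& wt x == w, wt y == w & #|[set i | x i && y i]| == w.-1].

Definition cell n w (C1 : {set bvec n}) (i : 'I_2) : {set bvec n} :=
  if i == ord0 then C1 else Vtx n w :\: C1.

Definition equitable2 n w (C1 : {set bvec n}) (S : 'M[nat]_2) : Prop :=
  [/\ C1 \subset Vtx n w, C1 != set0, Vtx n w :\: C1 != set0 &
      forall (i j : 'I_2) x, x \in cell w C1 i ->
        #|[set y in cell w C1 j | adjJ w x y]| = S i j].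

Definition lam2 (w : nat) : rat := (((w%:Z - 2) ^+ 2 - 2)%:~R)%R.

Definition permx n (s : 'S_n) (x : bvec n) : bvec n := [ffun i => x (s i)].

Definition equiv_char n w (C D : {set bvec n}) : Prop :=
  exists s : 'S_n, forall x, x \in Vtx n w -> (x \in C) = (permx s x \in D).

Definition equiv_part n w (C1 D1 : {set bvec n}) : Prop :=
  equiv_char w C1 D1 \/ equiv_char w C1 (Vtx n w :\: D1).

Definition coord n (x : bvec n) (k : nat) : bool :=
  [exists i : 'I_n, (val i == k) && x i].

Definition prefix n (x : bvec n) (m : nat) : seq nat :=
  [seq nat_of_bool (coord x k) | k <- iota 0 m].

Definition B1 : seq (seq nat) :=
  [:: [::1;0;0;0;0]; [::1;1;0;0;0]; [::1;0;1;0;0]; [::0;0;0;1;1];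
      [::0;1;1;1;1]; [::0;0;1;1;1]; [::0;1;0;1;1]; [::1;1;1;0;0]].

Definition B3 : seq (seq nat) :=
  [:: [::0;0;0;0;0]; [::0;0;1;0;0]; [::0;0;0;1;0]; [::0;0;0;0;1];
      [::1;0;1;0;0]; [::0;1;0;1;0]; [::0;0;1;0;1]; [::0;0;0;1;1];
      [::1;1;1;1;1]; [::1;1;0;1;1]; [::1;1;1;0;1]; [::1;1;1;1;0];
      [::0;1;0;1;1]; [::1;0;1;0;1]; [::1;1;0;1;0]; [::1;1;1;0;0]].

(* first cells of P_1, ..., P_4 in J(2w,w) *)
Definition P1 w : {set bvec (2 * w)} := [set x in Vtx (2 * w) w | prefix x 5 \in B1].
Definition P2 w : {set bvec (2 * w)} :=
  [set x in Vtx (2 * w) w | (coord x 0 + coord x 1 == 0)%N || (coord x 0 + coord x 1 == 2)%N].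
Definition P3 w : {set bvec (2 * w)} := [set x in Vtx (2 * w) w | prefix x 5 \in B3].
Definition P4 w : {set bvec (2 * w)} :=
  [set x in Vtx (2 * w) w | prefix x 3 \in [:: [::0;0;0]; [::1;1;1]]].

Definition is_mx22 (S : 'M[nat]_2) (a b c d : nat) : bool :=
  [&& S ord0 ord0 == a, S ord0 ord_max == b, S ord_max ord0 == c & S ord_max ord_max == d].

Definition listed_mx (w : nat) (S : 'M[nat]_2) : bool :=
  [|| is_mx22 S (w^2 - 3*w + 2) (3*w - 2) w (w^2 - w),
      is_mx22 S (w^2 - 2*w) (2*w) (2*w - 2) (w^2 - 2*w + 2)
    | is_mx22 S (w^2 - 3*w) (3*w) (w - 2) (w^2 - w + 2)].

(* quotient matrix of (C2, C1) *)
Definition swap_mx (S : 'M[nat]_2) : 'M[nat]_2 :=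
  \matrix_(i, j) S (rev_ord i) (rev_ord j).

(* Main.v *)
Require Import Defs.
From mathcomp Require Import all_boot all_order all_fingroup all_algebra.
From mathcomp Require Import zify ring lra.

(* Let [F] be the characteristic function of [C1]. Summing [F x - F (sw p q x)]
   over all pairs of coordinates turns the eigenvalue condition into an equation
   for a Laplacian [lap], and passing from [h] to the difference [diff i j h]
   removes [i], [j] and lowers the eigenvalue. After two disjoint differences the
   eigenvalue is 0, so second differences are constant, and each [diff i j F] is
   affine on its slice with values in {-1, 0, 1}. Choosing a maximum point and
   recentring the coefficients there gives (with [chi] = +-1)
     2 * diff i j F = sum_k b_k chi_k,   b integral,   sum_k |b_k| = 0 or 2.

   Computing the second moment of the right-hand side and counting the edges
   between the two cells gives w * sum_ij t_ij = 2 (2w-3) S_01 S_10 with natural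
   numbers t_ij that are at least w-2 unless swapping [i] and [j] preserves [F].
   For w = 4, 5 divisibility by w settles the quotient matrix. For w >= 6 it forces
   a class of at least four interchangeable coordinates. For a coordinate [i]
   outside this class the coefficients b live outside the class and are symmetric
   in [i] and [k]. Two coordinates [i], [j] that do not see each other
   cannot both be able to change [F] at the same point, which forces their supports
   to coincide; hence at most four coordinates lie outside the class. Then [F] is an
   even quadratic Boolean function of four variables, and there are few of these. For
   w = 6 a vertex avoiding the four coordinates has a number of neighbours in the
   other cell divisible by w. *)

Set Implicit Arguments. Unset Strict Implicit. Unset Printing Implicit Defensive.
Import Order.TTheory GRing.Theory Num.Theory.
Local Open Scope ring_scope.

(** * Coordinate swaps on a slice *)

Definition sw n (i j : 'I_n) (x : bvec n) : bvec n := permx (tperm i j) x.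

Lemma swE n (i j k : 'I_n) x : sw i j x k = x (tperm i j k).
Proof. by rewrite ffunE. Qed.

Lemma swL n (i j : 'I_n) x : sw i j x i = x j.
Proof. by rewrite swE tpermL. Qed.

Lemma swR n (i j : 'I_n) x : sw i j x j = x i.
Proof. by rewrite swE tpermR. Qed.

Lemma swD n (i j k : 'I_n) x : k != i -> k != j -> sw i j x k = x k.
Proof. by move=> ki kj; rewrite swE tpermD // eq_sym. Qed.

Lemma swK n (i j : 'I_n) : involutive (@sw n i j).
Proof. by move=> x; apply/ffunP => k; rewrite !swE tpermK. Qed.

Lemma swC n (i j : 'I_n) : @sw n i j =1 sw j i.
Proof. by move=> x; rewrite /sw tpermC. Qed.

Lemma sw_id n (i j : 'I_n) (x : bvec n) : x i = x j -> sw i j x = x.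
Proof. by move=> xij; apply/ffunP => k; rewrite swE; case: tpermP => [->|->|_ _]; rewrite ?xij. Qed.

Lemma permx_sw n (s : 'S_n) (k l : 'I_n) x :
  permx s (sw (s k) (s l) x) = sw k l (permx s x).
Proof.
apply/ffunP => m; rewrite !ffunE; congr (x _).
case: (tpermP k l m) => [->|->|/eqP mk /eqP ml]; rewrite ?tpermL ?tpermR //.
by rewrite tpermD // eq_sym (inj_eq perm_inj).
Qed.

Lemma sw_comm n (i j k l : 'I_n) x : i != k -> i != l -> j != k -> j != l ->
  sw i j (sw k l x) = sw k l (sw i j x).
Proof.
move=> ik il jk jl; have := permx_sw (tperm i j) k l x.
by rewrite !tpermD // => e; rewrite /sw e.
Qed.

Lemma sw_conj n (i j k : 'I_n) x : i != k -> j != k ->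
  sw i k x = sw i j (sw j k (sw i j x)).
Proof.
move=> ik jk; have := permx_sw (tperm i j) i k (sw i j x).
by rewrite tpermL tpermD // -!/(sw i j _) swK.
Qed.

Lemma wt_permx n (s : 'S_n) x : wt (permx s x) = wt x.
Proof.
rewrite /wt -[RHS](card_preimset _ (@perm_inj _ s)).
by apply: eq_card => k; rewrite !inE ffunE.
Qed.

Lemma permx_Vtx n w (s : 'S_n) x : (permx s x \in Vtx n w) = (x \in Vtx n w).
Proof. by rewrite !inE wt_permx. Qed.

Lemma sw_Vtx n w (i j : 'I_n) x : (sw i j x \in Vtx n w) = (x \in Vtx n w).
Proof. exact: permx_Vtx. Qed.

Lemma wt_sum n (x : bvec n) : (\sum_k x k)%N = wt x.
Proof. by rewrite /wt -sum1dep_card [RHS]big_mkcond; apply: eq_bigr => k _; case: (x k). Qed.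

Definition swap_closed n (W : {set 'I_n}) (D : {set bvec n}) :=
  forall x p q, x \in D -> p \in W -> q \in W -> sw p q x \in D.

(** Induction on the number of coordinates where [x] and [y] differ. Equal weights give a one of [x]
    that is a zero of [y], and conversely; both lie in [W], and swapping them brings [x] closer to
    [y]. *)
Lemma sw_connect n (T : Type) (h : bvec n -> T) (W : {set 'I_n}) (D : {set bvec n}) x y :
    swap_closed W D ->
    (forall x p q, x \in D -> p \in W -> q \in W -> h (sw p q x) = h x) ->
  x \in D -> wt x = wt y -> (forall k, k \notin W -> x k = y k) -> h x = h y.
Proof.
move=> Dcl hinv; have [m] := ubnP #|[set k | x k != y k]|.
elim: m x => // m IH x le_m Dx wxy xyW.
have [->//|neq_xy] := eqVneq x y.
have sxy : [set k | x k] != [set k | y k].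
  apply: contra neq_xy => /eqP/setP exy; apply/eqP/ffunP => k.
  by have := exy k; rewrite !inE.
have [p xp yp] : exists2 p, x p & ~~ y p.
  have: ~~ ([set k | x k] \subset [set k | y k]).
    apply: contra sxy => sub; rewrite eqEcard sub /=.
    by move: wxy; rewrite /wt => ->.
  by case/subsetPn => p; rewrite !inE; exists p.
have [q yq xq] : exists2 q, y q & ~~ x q.
  have: ~~ ([set k | y k] \subset [set k | x k]).
    apply: contra sxy => sub; rewrite eq_sym eqEcard sub /=.
    by move: wxy; rewrite /wt => ->.
  by case/subsetPn => q; rewrite !inE; exists q.
have Wp : p \in W by apply: contraLR xp => /xyW ->.
have Wq : q \in W by apply: contraLR yq => /xyW <-.
have pq : p != q by apply: contraNneq yp => ->.
rewrite -(hinv x p q Dx Wp Wq); apply: IH.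
- apply: (@leq_trans #|[set k | x k != y k]|); last exact: le_m.
  apply: proper_card; apply/properP; split.
    apply/subsetP => k; rewrite !inE swE.
    case: (tpermP p q k) => [->|->|//]; first by rewrite (negbTE xq) xp yp.
    by rewrite xp yq.
  by exists p; rewrite !inE ?swL ?xp ?(negbTE yp) // (negbTE xq).
- exact: Dcl.
- by rewrite wt_permx.
- move=> k kW; rewrite swD ?xyW //; by [apply: contraNneq kW => -> | apply: contraNneq kW => ->].
Qed.

(** The remaining [w - #|X|] ones are chosen outside [X] and [Y]; a positive binomial coefficient
    shows that there is room. *)
Lemma slice_point n w (X Y : {set 'I_n}) :
  [disjoint X & Y] -> (#|X| <= w)%N -> (w + #|Y| <= n)%N ->
  exists x, [/\ x \in Vtx n w, {in X, forall k, x k} & {in Y, forall k, x k = false}].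
Proof.
move=> dXY leX leY.
have cXY : #|X :|: Y| = (#|X| + #|Y|)%N by rewrite cardsU disjoint_setI0 // cards0 subn0.
have : (0 < #|[set A : {set 'I_n} | A \subset ~: (X :|: Y) & #|A| == w - #|X|]|)%N.
  rewrite cards_draws bin_gt0.
  by have := cardsC (X :|: Y); rewrite cXY card_ord; lia.
case/card_gt0P => A; rewrite inE => /andP[/subsetP sA /eqP cA].
exists [ffun k => k \in X :|: A]; split.
- rewrite inE /wt; apply/eqP.
  rewrite (eq_card (B := X :|: A)); last by move=> k; rewrite inE ffunE.
  rewrite cardsU disjoint_setI0 ?cards0; first by rewrite cA; lia.
  by apply/pred0P => k /=; apply/negP => /andP[kX /sA]; rewrite !inE kX.
- by move=> k kX; rewrite ffunE inE kX.
- move=> k kY; rewrite ffunE inE (disjointFl dXY kY) /=.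
  by apply/negP => /sA; rewrite !inE kY orbT.
Qed.

Lemma slice_seq w (r s : seq 'I_(2 * w)) :
    ~~ has (mem r) s -> (size r <= w)%N -> (size s <= w)%N ->
  exists x, [/\ x \in Vtx (2 * w) w, all x r & all (predC x) s].
Proof.
move=> /hasPn rs ler les.
have [||| x [Vx xr xs]] := @slice_point (2 * w) w [set k in r] [set k in s].
- apply/pred0P => k /=; rewrite !inE; apply/negP => /andP[kr /rs].
  by rewrite /= kr.
- by rewrite cardsE (leq_trans (card_size r)).
- apply: (@leq_trans (w + w)); last by rewrite mul2n addnn.
  by rewrite cardsE leq_add2l (leq_trans (card_size s)).
- exists x; split=> //; apply/allP => k ki; first by apply: xr; rewrite inE.
  by rewrite /= xs // inE.
Qed.

(** * The swap Laplacian *)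

Definition diff n (i j : 'I_n) (h : bvec n -> int) x : int := h x - h (sw i j x).

Lemma diffE n (i j : 'I_n) h x : diff i j h x = h x - h (sw i j x).
Proof. by []. Qed.

(** Ordered pairs are summed, so each transposition counts twice; hence the factor 2 in the
    eigenvalue equations. *)
Definition lap n (W : {set 'I_n}) (h : bvec n -> int) x : int :=
  \sum_(p in W) \sum_(q in W) diff p q h x.

Lemma diff_id n (i j : 'I_n) h (x : bvec n) : x i = x j -> diff i j h x = 0.
Proof. by move=> xij; rewrite /diff sw_id // subrr. Qed.

Lemma diffC n (i j : 'I_n) h x : diff i j h x = diff j i h x.
Proof. by rewrite /diff swC. Qed.

Lemma lap_sw n (W : {set 'I_n}) h i j x : i \in W -> j \in W ->
  lap W (fun y => h (sw i j y)) x = lap W h (sw i j x).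
Proof.
move=> Wi Wj; have tW k : (tperm i j k \in W) = (k \in W).
  by case: tpermP => [->|->|]; rewrite ?Wi ?Wj.
have tK : {on [pred k | k \in W], bijective (tperm i j)}.
  by exists (tperm i j) => k _; rewrite tpermK.
rewrite /lap [RHS](reindex_inj (@perm_inj _ (tperm i j))) /=.
apply: eq_big => [p|p _]; first by rewrite tW.
rewrite [RHS](reindex_inj (@perm_inj _ (tperm i j))) /=.
apply: eq_big => [q|q _]; first by rewrite tW.
rewrite /diff; congr (_ - h _).
by have := permx_sw (tperm i j) (tperm i j p) (tperm i j q) x; rewrite !tpermK.
Qed.

(** The constant [gam] cancels in the difference [g], so [g] satisfies a homogeneous equation over
    [W]. The pairs meeting [i] or [j] contribute exactly [2 * #|W| * g], and dropping them lowers
    [kap] by [#|W|]. *)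
Lemma lap_diff n (W : {set 'I_n}) (D : {set bvec n}) h (kap gam : int) i j :
    i \in W -> j \in W -> swap_closed W D ->
    (forall x, x \in D -> lap W h x = 2 * (kap * h x - gam)) ->
  forall x, x \in D -> x i != x j ->
    lap (W :\ i :\ j) (diff i j h) x = 2 * (kap - #|W|%:Z) * diff i j h x.
Proof.
move=> Wi Wj Dcl hD x Dx xij.
have nij : i != j by apply: contraNneq xij => ->.
have Wj' : j \in W :\ i by rewrite !inE eq_sym nij.
set g := diff i j h; set U := _ :\ j.
have e1 : lap W g x = 2 * kap * g x.
  have -> : lap W g x = lap W h x - lap W (fun y => h (sw i j y)) x.
    rewrite /lap -sumrB; apply: eq_bigr => p _; rewrite -sumrB.
    by apply: eq_bigr => q _; rewrite /g /diff; ring.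
  by rewrite lap_sw // !hD ?Dcl // /g /diff; ring.
have split1 (F : 'I_n -> int) : \sum_(p in W) F p = F i + F j + \sum_(p in U) F p.
  by rewrite (big_setD1 i) //= (big_setD1 j) //= addrA.
have gij : diff i j g x = 2 * g x by rewrite /g /diff swK; ring.
(* As [x i] and [x j] differ, [x p] agrees with one of them. Swapping [p] with that coordinate does
   nothing; swapping it with the other equalises the values at [i] and [j], where [g] vanishes. *)
have gU p : p \in U -> diff i p g x + diff j p g x = g x.
  rewrite !inE => /and3P[pj pi _].
  case: (boolP (x p == x i)) => [/eqP xpi|xpi].
    rewrite diff_id // add0r {1}/diff.
    suff -> : g (sw j p x) = 0 by rewrite subr0.
    by rewrite /g diff_id // swL swD // eq_sym.
  have xpj : x p = x j by move: xpi xij; case: (x p) (x i) (x j) => [] [] [].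
  rewrite [X in _ + X]diff_id // addr0 /diff.
  suff -> : g (sw i p x) = 0 by rewrite subr0.
  by rewrite /g diff_id // swL swD // eq_sym.
have cU : #|W|%:Z = #|U|%:Z + 2.
  by rewrite (cardsD1 i) Wi (cardsD1 j (W :\ i)) Wj' -/U; lia.
have e2 : lap W g x = 4 * g x + 2 * (#|U|%:Z * g x) + lap U g x.
  have sU : \sum_(p in U) (diff i p g x + diff j p g x) = #|U|%:Z * g x.
    rewrite (eq_bigr (fun=> g x)) => [|p Up]; last exact: gU.
    by rewrite sumr_const -mulr_natl natz.
  have rowU : \sum_(p in U) \sum_(q in W) diff p q g x = #|U|%:Z * g x + lap U g x.
    rewrite -sU /lap -big_split /=; apply: eq_bigr => p _.
    by rewrite split1 !(diffC p).
  move: sU; rewrite big_split /= /lap split1 rowU !split1 => sU.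
  by rewrite (@diff_id _ i i) // (@diff_id _ j j) // (diffC j i) gij -sU; ring.
have -> : lap U g x = lap W g x - (4 * g x + 2 * (#|U|%:Z * g x)) by rewrite e2; ring.
rewrite e1 cU. ring.
Qed.

(** Energy argument: swaps permute [D], so the squared differences add up to twice the pairing of
    [h] with [lap W h], which is 0; hence every square vanishes. *)
Lemma harmonic_sw n (W : {set 'I_n}) (D : {set bvec n}) h :
    swap_closed W D -> (forall x, x \in D -> lap W h x = 0) ->
  forall x p q, x \in D -> p \in W -> q \in W -> h (sw p q x) = h x.
Proof.
move=> Dcl hD.
have energy p q : p \in W -> q \in W ->
    \sum_(x in D) (diff p q h x) ^+ 2 = 2 * \sum_(x in D) h x * diff p q h x.
  move=> Wp Wq.
  have re : \sum_(x in D) h (sw p q x) ^+ 2 = \sum_(x in D) h x ^+ 2.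
    rewrite [RHS](reindex_inj (inv_inj (@swK _ p q))) /=; apply: eq_bigl => x.
    by apply/idP/idP => [Dx|/(Dcl _ p q)]; [exact: Dcl | rewrite swK; apply].
  apply/eqP; rewrite -subr_eq0 mulr_sumr -sumrB.
  rewrite (eq_bigr (fun x => h (sw p q x) ^+ 2 - h x ^+ 2)) => [|x _]; last by rewrite /diff; ring.
  by rewrite sumrB re subrr.
have tot : \sum_(p in W) \sum_(q in W) \sum_(x in D) (diff p q h x) ^+ 2 = 0.
  transitivity (2 * \sum_(x in D) h x * lap W h x).
    have -> : \sum_(x in D) h x * lap W h x =
        \sum_(p in W) \sum_(q in W) \sum_(x in D) h x * diff p q h x.
      rewrite (eq_bigr (fun x => \sum_(p in W) \sum_(q in W) h x * diff p q h x)).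
        rewrite exchange_big /=; apply: eq_bigr => p _.
        by rewrite exchange_big.
      by move=> x _; rewrite /lap mulr_sumr; apply: eq_bigr => p _; rewrite mulr_sumr.
    rewrite mulr_sumr; apply: eq_bigr => p Wp.
    rewrite mulr_sumr; apply: eq_bigr => q Wq.
    exact: energy.
  by rewrite big1 ?mulr0 // => x /hD ->; rewrite mulr0.
move=> x p q Dx Wp Wq.
have sq0 r s : 0 <= \sum_(y in D) (diff r s h y) ^+ 2 by apply: sumr_ge0 => y _; exact: sqr_ge0.
have s0 r : 0 <= \sum_(s in W) \sum_(y in D) (diff r s h y) ^+ 2 by apply: sumr_ge0.
have /(_ p Wp) := psumr_eq0P (fun r _ => s0 r) tot.
move=> /(psumr_eq0P (fun s _ => sq0 p s)) /(_ q Wq).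
move=> /(psumr_eq0P (fun y _ => sqr_ge0 _)) /(_ x Dx) /eqP.
by rewrite sqrf_eq0 subr_eq0 => /eqP ->.
Qed.

(** * Differences of an eigenfunction *)

Lemma mulrn_int (x : int) n : x *+ n = n%:Z * x.
Proof. by rewrite -mulr_natl natz. Qed.

Definition chi n (x : bvec n) k : int := if x k then 1 else -1.

Lemma sum_chi n w (x : bvec n) : x \in Vtx n w -> \sum_k chi x k = 2 * w%:Z - n%:Z.
Proof.
rewrite inE => /eqP <-.
rewrite (eq_bigr (fun k => 2 * (x k : nat)%:Z - 1)) => [|k _]; last first.
  by rewrite /chi; case: (x k).
rewrite sumrB -mulr_sumr sumr_const card_ord -wt_sum.
by rewrite (big_morph Posz PoszD (erefl _)); congr (_ - _); exact: natz.
Qed.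

Definition ind n (f : bvec n -> bool) x : int := if f x then 1 else 0.

Section Label.
Variables (w : nat) (f : bvec (2 * w) -> bool) (c : int).
Hypothesis w_ge4 : (4 <= w)%N.
Hypothesis lap_ind : forall x, x \in Vtx (2 * w) w ->
  lap setT (ind f) x = 2 * ((4 * w%:Z - 2) * ind f x - c).

Local Notation V := (Vtx (2 * w) w).

Section Edge.
Variables i j : 'I_(2 * w).
Hypothesis nij : i != j.

Let D := [set x in V | x i && ~~ x j].
Let W := [set~ i] :\ j.
Let g := diff i j (ind f).

Let DP x : reflect [/\ x \in V, x i & x j = false] (x \in D).
Proof. by rewrite [x \in D]in_set; apply: (iffP and3P) => -[-> ->]; [move/negbTE | move=> ->]. Qed.

Let WP k : reflect (k != i /\ k != j) (k \in W).
Proof. by rewrite !inE andbC; exact: andP. Qed.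

Let D_closed : swap_closed W D.
Proof.
move=> x p q /DP[Vx xi xj] /WP[pi pj] /WP[qi qj]; apply/DP.
by rewrite sw_Vtx !swD // eq_sym.
Qed.

Let cardW : #|W|%:Z = 2 * w%:Z - 2.
Proof.
have := cardsC [set i; j]; rewrite cards2 nij card_ord.
suff -> : ~: [set i; j] = W by move=> ?; lia.
by apply/setP => k; rewrite !inE negb_or andbC.
Qed.

Let W_E : W = [set: 'I_(2 * w)] :\ i :\ j.
Proof. by apply/setP => k; rewrite !inE andbT. Qed.

(** The initial constant [4w - 2] is the valency [w^2] minus [lam2 w]. Removing [i] and [j] costs
    [2w] and leaves [2w - 2 = #|W|], so one more difference inside [W] is harmonic. *)
Let lap_g x : x \in D -> lap W g x = 2 * (2 * w%:Z - 2) * g x.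
Proof.
move=> /DP[Vx xi xj]; rewrite W_E (@lap_diff _ _ V _ (4 * w%:Z - 2) c) //.
- by rewrite cardsT card_ord; congr (2 * _ * _); lia.
- by move=> y p q; rewrite sw_Vtx.
- by rewrite xi xj.
Qed.

(** The second difference has eigenvalue 0, so [harmonic_sw] makes it invariant under swaps avoiding
    all four coordinates, and [sw_connect] then makes it constant. *)
Let diff_const k l x y : k \in W -> l \in W -> k != l ->
    x \in D -> y \in D -> x k -> x l = false -> y k -> y l = false ->
  diff k l g x = diff k l g y.
Proof.
move=> Wk Wl nkl Dx Dy xk xl yk yl; have [ki kj] := WP k Wk; have [li lj] := WP l Wl.
pose D2 := [set x in D | x k && ~~ x l]; pose W2 := W :\ k :\ l.
have D2P z : reflect [/\ z \in D, z k & z l = false] (z \in D2).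
  by rewrite [z \in D2]in_set; apply: (iffP and3P) => -[-> ->]; [move/negbTE | move=> ->].
have D2_closed : swap_closed W2 D2.
  move=> z p q /D2P[Dz zk zl] /setD1P[pl /setD1P[pk Wp]] /setD1P[ql /setD1P[qk Wq]]; apply/D2P.
  by rewrite !swD ?D_closed // eq_sym.
have W2x z : z \in D2 -> lap W2 (diff k l g) z = 0.
  move=> /D2P[Dz zk zl].
  rewrite (@lap_diff _ W D _ (2 * w%:Z - 2) 0) // ?zk ?zl // => [|z' /lap_g ->]; last by ring.
  by rewrite cardW; ring.
have /DP[Vx xi xj] := Dx; have /DP[Vy yi yj] := Dy.
apply: (@sw_connect _ _ _ W2 D2) => //.
- exact: harmonic_sw.
- exact/D2P.
- by move: Vx Vy; rewrite !inE => /eqP-> /eqP->.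
- move=> m; rewrite !inE !negb_and !negbK.
  by move=> /or4P[] /eqP ->; rewrite ?xk ?xl ?xi ?xj.
Qed.

(** Together with [i] and [j], at most four ones and four zeros are prescribed, which [4 <= w]
    allows. *)
Let witness (r s : seq 'I_(2 * w)) : all (mem W) r -> all (mem W) s ->
    ~~ has (mem r) s -> (size r < 4)%N -> (size s < 4)%N ->
  exists x, [/\ x \in D, all x r & all (predC x) s].
Proof.
move=> /allP Wr /allP Ws /hasPn rs ler les.
have [||| x [Vx /= /andP[xi xr] /andP[xj xs]]] := @slice_seq w (i :: r) (j :: s).
- apply/hasPn => k; rewrite in_cons => /predU1P[->|ks]; rewrite /= in_cons.
    by rewrite eq_sym (negbTE nij); apply/negP => /Wr/WP[_ /eqP].
  by rewrite negb_or rs // andbT; have /WP[] := Ws _ ks.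
- exact: leq_trans w_ge4.
- exact: leq_trans w_ge4.
- by exists x; split=> //; apply/DP; rewrite (negbTE xj).
Qed.

Let sum_chi_W x : x \in D -> \sum_(k in W) chi x k = 0.
Proof.
move=> /DP[Vx xi xj]; rewrite (eq_bigl (fun k => (k != i) && (k != j))) => [|k].
  2: exact/WP/andP.
have := sum_chi Vx; rewrite (bigD1 i) //= (bigD1 j) 1?eq_sym //= {1 2}/chi xi xj.
set s := \sum_(k | _) _; lia.
Qed.

(** The constant second differences satisfy a cocycle identity and so come from a potential: [a k]
    is the constant of the pair [k], [r0] for a base coordinate [r0]. *)
Let slope : exists a : 'I_(2 * w) -> int, forall k l x, k \in W -> l \in W ->
  x \in D -> x k -> x l = false -> diff k l g x = a k - a l.
Proof.
have [r0 Wr0] : exists r0, r0 \in W by apply/set0Pn; rewrite -card_gt0; have := cardW; lia.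
have zP k : exists z, k \in W -> k != r0 -> [/\ z \in D, z k & z r0 = false].
  have [/andP[Wk kr0]|nk] := boolP ((k \in W) && (k != r0)); last first.
    by exists [ffun=> true] => Wk kr0; rewrite Wk kr0 in nk.
  have [||||| z] := @witness [:: k] [:: r0]; rewrite /= ?Wk ?Wr0 ?mem_seq1 ?orbF ?(eq_sym r0) //.
  by move=> [Dz]; rewrite /= !andbT => zk /negbTE zr; exists z.
have [z {}zP] := fin_all_exists zP.
pose a k := diff k r0 g (z k); have ar0 : a r0 = 0 by rewrite /a diff_id.
exists a => k l x Wk Wl Dx xk xl.
have nkl : k != l by apply: contraTneq xk => ->; rewrite xl.
have aE m y : m \in W -> m != r0 -> y \in D -> y m -> y r0 = false -> diff m r0 g y = a m.
  by move=> Wm mr Dy ym yr; have [] := zP m Wm mr => *; apply: diff_const.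
have [lr|lr] := eqVneq l r0.
  by rewrite lr ar0 subr0 aE // -lr.
have [kr|kr] := eqVneq k r0.
  rewrite kr ar0 sub0r -(aE l (sw k l x)) ?D_closed ?swR ?swL //; last by rewrite -kr swL.
  rewrite -kr (diffC l k) (diffE k l g x) (diffE k l g (sw k l x)) swK; ring.
(* Moving a one from [k] to [l] and then to [r0] amounts to moving it from [k] to [r0], so the
   differences telescope. *)
have [||||| y [Dy]] := @witness [:: k] [:: l; r0]; rewrite /= ?Wk ?Wl ?Wr0 ?mem_seq1 ?orbF //.
  by rewrite negb_or eq_sym nkl eq_sym kr.
rewrite !andbT => yk /andP[/negbTE yl /negbTE yr].
rewrite (diff_const _ _ nkl Dx Dy) // -(aE k y) // -(aE l (sw k l y)) ?D_closed ?swR //; last first.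
  by rewrite swD // eq_sym.
suff e : sw l r0 (sw k l y) = sw k r0 y by rewrite !diffE e; ring.
have kl : l != k by rewrite eq_sym.
have rl : r0 != l by rewrite eq_sym.
have rk : r0 != k by rewrite eq_sym.
apply/ffunP => m; rewrite !swE.
have [->|ml] := eqVneq m l; first by rewrite tpermL tpermD // tpermD // yl yr.
have [->|mr] := eqVneq m r0; first by rewrite !tpermR.
have [->|mk] := eqVneq m k; first by rewrite (tpermD (x := l)) // !tpermL yl yr.
by rewrite !tpermD // eq_sym.
Qed.

(* The maximum of [g] over [D] is half the l1-norm of the recentred coefficients. *)
Lemma label : exists b : 'I_(2 * w) -> int,
  [/\ b i = 0 /\ b j = 0, \sum_k `|b k| = 0 \/ \sum_k `|b k| = 2 &
      forall x, x \in V -> x i -> x j = false ->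
        2 * diff i j (ind f) x = \sum_k b k * chi x k].
Proof.
have [a slope_a] := slope.
(* The eigenvalue equation recovers [g] from its slopes: [2 * diff p q g x] equals
   [(a p - a q) * (chi x p - chi x q)], and [sum_chi_W] kills the cross terms of the double sum. *)
have ga x : x \in D -> 2 * g x = \sum_(k in W) a k * chi x k.
  move=> Dx; have := lap_g Dx; rewrite /lap => e.
  have {}e : 2 * (2 * (2 * w%:Z - 2) * g x) =
      2 * (2 * w%:Z - 2) * \sum_(k in W) a k * chi x k.
    transitivity (\sum_(p in W) \sum_(q in W) (a p - a q) * (chi x p - chi x q)).
      rewrite -e mulr_sumr; apply: eq_bigr => p Wp; rewrite mulr_sumr; apply: eq_bigr => q Wq.
      rewrite /chi; case xp: (x p); case xq: (x q).
      - by rewrite diff_id ?xp ?xq // subrr !mulr0.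
      - by rewrite (slope_a _ _ x Wp Wq) //; ring.
      - by rewrite diffC (slope_a _ _ x Wq Wp) //; ring.
      - by rewrite diff_id ?xp ?xq // subrr !mulr0.
    have -> : \sum_(p in W) \sum_(q in W) (a p - a q) * (chi x p - chi x q) =
        \sum_(p in W) (#|W|%:Z * (a p * chi x p) + (\sum_(q in W) a q * chi x q
          - chi x p * \sum_(q in W) a q)).
      apply: eq_bigr => p _.
      rewrite (eq_bigr (fun q => a p * chi x p + (a q * chi x q - chi x p * a q) - a p * chi x q)).
        by rewrite sumrB -mulr_sumr sum_chi_W // mulr0 subr0 big_split /= sumr_const
          sumrB -mulr_sumr mulrn_int.
      by move=> q _; ring.
    rewrite big_split /= -mulr_sumr sumrB sumr_const -mulr_suml sum_chi_W // mul0r subr0.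
    by rewrite mulrn_int cardW; ring.
  apply: (@mulfI _ (2 * (2 * w%:Z - 2))); first by apply/eqP; lia.
  by rewrite -e; ring.
have [x0 [Dx0 _ _]] := @witness [::] [::] isT isT isT isT isT.
case: (Order.TotalTheory.arg_maxP g Dx0) => z Dz zmax.
have [k0 /andP[Wk0 zk0]] : exists k, (k \in W) && z k.
  have : (2 < wt z)%N by move: Dz => /DP[]; rewrite inE => /eqP ->; lia.
  rewrite /wt => cz; apply/existsP; rewrite -[X in is_true X]negbK negb_exists.
  apply/negP => /forallP nW; move: cz; rewrite ltnNge => /negP[].
  rewrite (leq_trans (subset_leq_card (_ : _ \subset [set i; j]))) //; last by rewrite cards2; case: (_ != _).
  by apply/subsetP => k; rewrite !inE => zk; have := nW k; rewrite zk andbT !inE negb_and !negbK orbC.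
case: (@Order.TotalTheory.arg_minP _ _ _ k0 [pred k | (k \in W) && z k] a) => [|k1 /andP[Wk1 zk1] k1min].
  by rewrite /= Wk0.
(* Subtracting the constant [a k1] preserves the form, because [chi] sums to 0 over [W]. By the
   choice of [k1] and by [le_a], [b] is nonnegative on the ones of [z] and nonpositive on its zeros,
   so every term at [z] equals [|b k|]. *)
pose b k := if k \in W then a k - a k1 else 0.
have bE x : x \in D -> \sum_k b k * chi x k = 2 * g x.
  move=> Dx; rewrite ga // (bigID (mem W)) /= [X in _ + X]big1 ?addr0 => [|k /negbTE Wk].
    rewrite (eq_bigr (fun k => a k * chi x k - a k1 * chi x k)) => [|k Wk].
      by rewrite sumrB -mulr_sumr sum_chi_W // mulr0 subr0.
    by rewrite /b Wk; ring.
  by rewrite /b Wk mul0r.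
have le_a k l : k \in W -> l \in W -> z k -> z l = false -> a l <= a k.
  move=> Wk Wl zk zl; rewrite -subr_ge0 -(slope_a k l z) //.
  by rewrite subr_ge0; apply: (zmax _ (D_closed Dz Wk Wl)).
have absb : \sum_k `|b k| = 2 * g z.
  rewrite -bE //; apply: eq_bigr => k _; rewrite /b; case: ifP => Wk; last by rewrite normr0 mul0r.
  rewrite /chi; case: ifP => zk.
    by rewrite mulr1 ger0_norm // subr_ge0; apply: k1min; rewrite /= Wk.
  by rewrite mulrN1 ler0_norm // subr_le0; apply: le_a.
exists b; split.
- by rewrite /b !inE !eqxx andbF.
- rewrite absb; have : 0 <= 2 * g z by rewrite -absb; apply: sumr_ge0.
  rewrite /g /diff /ind; case: (f z); case: (f _); lia.
- by move=> x Vx xi xj; rewrite bE //; apply/DP.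
Qed.

End Edge.
End Label.

(** * Second moments on a slice *)

Lemma Posz_sum (I : Type) (r : seq I) (P : pred I) (F : I -> nat) :
  (\sum_(i <- r | P i) F i)%N%:Z = \sum_(i <- r | P i) (F i)%:Z.
Proof. exact: (big_morph Posz PoszD (erefl _)). Qed.

Lemma sum_sw n w (i j : 'I_n) (F : bvec n -> int) :
  \sum_(x in Vtx n w) F (sw i j x) = \sum_(x in Vtx n w) F x.
Proof.
rewrite [RHS](reindex_inj (inv_inj (@swK _ i j))) /=.
by apply: eq_bigl => x; rewrite sw_Vtx.
Qed.

Lemma card_slice_one w (i : 'I_(2 * w)) : (0 < w)%N ->
  2 * \sum_(x in Vtx (2 * w) w) (x i : nat)%:Z = #|Vtx (2 * w) w|%:Z.
Proof.
move=> w0; set M := \sum_(x in _) _.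
have eM k : \sum_(x in Vtx (2 * w) w) (x k : nat)%:Z = M.
  by rewrite -(sum_sw _ i k) /M; apply: eq_bigr => x _; rewrite swR.
have : \sum_k \sum_(x in Vtx (2 * w) w) (x k : nat)%:Z = w%:Z * #|Vtx (2 * w) w|%:Z.
  rewrite exchange_big /= (eq_bigr (fun=> w%:Z)) => [|x]; last first.
    by rewrite inE -Posz_sum wt_sum => /eqP->.
  by rewrite sumr_const mulrn_int mulrC.
rewrite (eq_bigr (fun=> M)) => [|k _]; last exact: eM.
rewrite sumr_const card_ord mulrn_int => e.
by apply: (@mulfI _ w%:Z); [apply/eqP; lia | rewrite -e PoszM; ring].
Qed.

Definition slice10 w (i j : 'I_(2 * w)) := [set x in Vtx (2 * w) w | x i && ~~ x j].

Lemma slice10P w (i j : 'I_(2 * w)) x :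
  reflect [/\ x \in Vtx (2 * w) w, x i & x j = false] (x \in slice10 i j).
Proof.
rewrite [x \in slice10 _ _]in_set.
by apply: (iffP and3P) => -[-> ->]; [move/negbTE | move=> ->].
Qed.

Lemma sum_slice10 w (i j : 'I_(2 * w)) (F : bvec (2 * w) -> int) :
  \sum_(x in slice10 i j) F x = \sum_(x in Vtx (2 * w) w) (x i && ~~ x j : nat)%:Z * F x.
Proof.
rewrite (eq_bigl (fun x => (x \in Vtx (2 * w) w) && (x i && ~~ x j))) => [|x]; last first.
  by rewrite [x \in slice10 _ _]in_set.
rewrite big_mkcondr; apply: eq_bigr => x _.
by case: (_ && _); rewrite ?mul1r ?mul0r.
Qed.

(** For fixed [i] the slices with [k != i] are equinumerous, and each point with a one at [i] lies
    in exactly [w] of them; [card_slice_one] counts those points. *)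
Lemma card_slice10 w (i j : 'I_(2 * w)) : i != j ->
  2 * (2 * w%:Z - 1) * #|slice10 i j|%:Z = w%:Z * #|Vtx (2 * w) w|%:Z.
Proof.
move=> nij; have w0 : (0 < w)%N by case: w i {j nij} => // -[].
have cE k : #|slice10 i k|%:Z = \sum_(x in Vtx (2 * w) w) (x i && ~~ x k : nat)%:Z.
  rewrite -sum1_card Posz_sum sum_slice10.
  by apply: eq_bigr => x _; rewrite mulr1.
have eN k : k != i -> #|slice10 i k|%:Z = #|slice10 i j|%:Z.
  move=> ki; rewrite !cE -(sum_sw _ j k); apply: eq_bigr => x _.
  by rewrite swR swD // eq_sym.
have : \sum_k #|slice10 i k|%:Z = w%:Z * \sum_(x in Vtx (2 * w) w) (x i : nat)%:Z.
  rewrite (eq_bigr _ (fun k _ => cE k)) exchange_big mulr_sumr; apply: eq_bigr => x.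
  rewrite inE => /eqP wx; case: (x i) => /=; last by rewrite big1 ?mulr0.
  have : (\sum_k (~~ x k : nat) + \sum_k (x k : nat) = 2 * w)%N.
    rewrite -big_split /= (eq_bigr (fun=> 1%N)) => [|k _]; last by case: (x k).
    by rewrite sum1_card card_ord.
  rewrite wt_sum wx -Posz_sum mulr1 => e; congr Posz.
  by apply: (@addIn w); rewrite [LHS]e mul2n addnn.
rewrite (bigD1 i) //= (eq_bigr (fun=> #|slice10 i j|%:Z)) => [|k ki]; last exact: eN.
have -> : #|slice10 i i| = 0%N.
  by apply: eq_card0 => x; apply/slice10P => -[_ ->].
rewrite sumr_const add0r mulrn_int.
have -> : #|[pred k : 'I_(2 * w) | k != i]|%:Z = 2 * w%:Z - 1.
  by have := cardC1 i; rewrite card_ord => ->; lia.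
by rewrite -(card_slice_one i w0) => e; rewrite -mulrA e; ring.
Qed.

(** On the slice [chi] sums to 0 over the [2w - 2] free coordinates. Multiplying by [chi x k] gives
    one diagonal term 1 and, by symmetry, [2w - 3] terms with equal sums. *)
Lemma sum_chi_slice10 w (i j k l : 'I_(2 * w)) :
    i != j -> k != i -> k != j -> l != i -> l != j -> k != l ->
  (2 * w%:Z - 3) * \sum_(x in slice10 i j) chi x k * chi x l = - #|slice10 i j|%:Z.
Proof.
move=> nij ki kj li lj kl.
pose C m := \sum_(x in slice10 i j) chi x k * chi x m.
have eC m : m != i -> m != j -> m != k -> C m = C l.
  move=> mi mj mk; rewrite /C !sum_slice10 -(sum_sw _ m l); apply: eq_bigr => x _.
  by rewrite !swD 1?eq_sym // /chi swL !swD // 1?eq_sym.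
have e0 x : x \in slice10 i j -> \sum_(m | (m != i) && (m != j)) chi x m = 0.
  move=> /slice10P[Vx xi xj]; have := sum_chi Vx.
  rewrite (bigD1 i) //= (bigD1 j) 1?eq_sym //= {1 2}/chi xi xj.
  by set s := \sum_(m | _) _; lia.
have : \sum_(m | (m != i) && (m != j)) C m = 0.
  rewrite exchange_big /= big1 // => x /e0 e; by rewrite -mulr_sumr e mulr0.
rewrite (bigD1 k) ?ki //= (eq_bigr (fun=> C l)) => [|m /andP[/andP[mi mj] mk]]; last exact: eC.
have -> : C k = #|slice10 i j|%:Z.
  rewrite /C -sum1_card Posz_sum; apply: eq_bigr => x _.
  by rewrite /chi; case: ifP.
rewrite sumr_const mulrn_int.
have -> : #|[pred m : 'I_(2 * w) | (m != i) && (m != j) && (m != k)]|%:Z = 2 * w%:Z - 3.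
  have := cardsC [set i; j; k]; rewrite card_ord setUC cardsU1 cards2 nij !inE negb_or ki kj.
  have -> : #|~: (k |: [set i; j])| = #|[pred m : 'I_(2 * w) | (m != i) && (m != j) && (m != k)]|.
    by apply: eq_card => m; rewrite !inE !negb_or andbC.
  by rewrite /= => ?; lia.
by move=> e; apply/eqP; rewrite -addr_eq0 addrC e.
Qed.

(** In the expanded square, distinct free coordinates have correlation [-1/(2w - 3)], and the
    coefficients at [i] and [j] vanish. *)
Lemma second_moment w (i j : 'I_(2 * w)) (b : 'I_(2 * w) -> int) :
    i != j -> b i = 0 -> b j = 0 ->
  (2 * w%:Z - 3) * \sum_(x in slice10 i j) (\sum_k b k * chi x k) ^+ 2 =
    #|slice10 i j|%:Z * ((2 * w%:Z - 2) * \sum_k b k ^+ 2 - (\sum_k b k) ^+ 2).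
Proof.
move=> nij bi bj.
have sqE (F : 'I_(2 * w) -> int) : (\sum_k F k) ^+ 2 = \sum_k \sum_l F k * F l.
  by rewrite expr2 mulr_suml; apply: eq_bigr => k _; rewrite mulr_sumr.
pose N := #|slice10 i j|%:Z.
have entry k l : b k * b l * ((2 * w%:Z - 3) * \sum_(x in slice10 i j) chi x k * chi x l) =
    N * ((2 * w%:Z - 2) * (if k == l then b k * b l else 0) - b k * b l).
  have [->|ki] := eqVneq k i; first by rewrite bi; case: eqP; rewrite !mul0r => *; ring.
  have [->|kj] := eqVneq k j; first by rewrite bj; case: eqP; rewrite !mul0r => *; ring.
  have [->|li] := eqVneq l i; first by rewrite bi; case: eqP; rewrite !mulr0 => *; ring.
  have [->|lj] := eqVneq l j; first by rewrite bj; case: eqP; rewrite !mulr0 => *; ring.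
  have [<-|kl] := eqVneq k l; last by rewrite sum_chi_slice10 // -/N; ring.
  suff -> : \sum_(x in slice10 i j) chi x k * chi x k = N by ring.
  rewrite /N -sum1_card Posz_sum; apply: eq_bigr => x _.
  by rewrite /chi; case: ifP.
transitivity (\sum_k \sum_l b k * b l *
    ((2 * w%:Z - 3) * \sum_(x in slice10 i j) chi x k * chi x l)).
  rewrite (eq_bigr _ (fun x _ => sqE (fun k => b k * chi x k))).
  rewrite exchange_big mulr_sumr; apply: eq_bigr => k _.
  rewrite exchange_big mulr_sumr; apply: eq_bigr => l _.
  rewrite mulrCA; congr (_ * _); rewrite mulr_sumr; apply: eq_bigr => x _.
  by ring.
rewrite (eq_bigr _ (fun k _ => eq_bigr _ (fun l _ => entry k l))).
rewrite sqE mulrBr !mulr_sumr -sumrB; apply: eq_bigr => k _.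
rewrite -[LHS]mulr_sumr -mulrBr; congr (_ * _).
rewrite sumrB -[X in X - _]mulr_sumr; congr (_ * _ - _).
by rewrite -big_mkcond (big_pred1 k) ?expr2 // => l; rewrite eq_sym.
Qed.

(** Let [Q] count the entries of absolute value 2 and let [U] be the negative mass. The squares sum
    to [2 + 2Q] and the entries to [2 - 2U], so [t = m(1 + Q) - (1 - U)^2]; since [0 <= U <= 2], the
    square is at most 1. *)
Lemma norm2_quarter (I : finType) (b : I -> int) (m : nat) : (0 < m)%N -> \sum_k `|b k| = 2 ->
  exists t : nat, (m <= t.+1)%N /\ m%:Z * 2 * \sum_k b k ^+ 2 - (\sum_k b k) ^+ 2 = 4 * t%:Z.
Proof.
move=> m0 b2; have bk k : `|b k| <= 2.
  by rewrite -b2 (bigD1 k) //= lerDl; apply: sumr_ge0.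
pose q k : nat := (`|b k|%N == 2)%N; pose u k : nat := if b k < 0 then `|b k|%N else 0%N.
have e1 : \sum_k b k ^+ 2 = 2 + 2 * \sum_k (q k)%:Z.
  rewrite -{1}b2 mulr_sumr -big_split; apply: eq_bigr => k _ /=; have bk2 := bk k.
  have : b k = 0 \/ b k = 1 \/ b k = 2 \/ b k = -1 \/ b k = -2 by lia.
  by rewrite /q => -[|[|[|[|]]]] ->.
have e2 : \sum_k b k = 2 - 2 * \sum_k (u k)%:Z.
  rewrite -{1}b2 mulr_sumr -sumrB; apply: eq_bigr => k _ /=; rewrite /u; case: ifP; lia.
have u0 : 0 <= \sum_k (u k)%:Z <= 2.
  by rewrite sumr_ge0 //= -b2; apply: ler_sum => k _; rewrite /u; case: ifP; lia.
have q0 : 0 <= \sum_k (q k)%:Z by apply: sumr_ge0.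
move: e1 e2 u0 q0; set Q := \sum_k (q k)%:Z; set U := \sum_k (u k)%:Z.
move=> -> -> U02 Q0; exists (absz (m%:Z * (1 + Q) - (1 - U) ^+ 2)%R).
have le : m%:Z - 1 <= m%:Z * (1 + Q) - (1 - U) ^+ 2.
  have : (1 - U) ^+ 2 <= 1.
    have /andP[U_ge0 U_le2] := U02.
    rewrite -subr_ge0 (_ : _ - _ = U * (2 - U)); last by ring.
    by rewrite mulr_ge0 // subr_ge0.
  have : 0 <= m%:Z * Q by apply: mulr_ge0.
  by lia.
set T := (m%:Z * (1 + Q) - (1 - U) ^+ 2)%R in le *.
have eT : (absz T)%:Z = T by rewrite gez0_abs //; lia.
split; first by rewrite -lez_nat -addn1 PoszD eT; lia.
by rewrite eT /T; ring.
Qed.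

(** * Counting crossing edges *)

Definition cross n (f : bvec n -> bool) (p q : 'I_n) (x : bvec n) : bool :=
  [&& x p, ~~ x q & f x != f (sw p q x)].

(** Pairs of a one and a zero of [x] index its neighbours, so this counts the neighbours on which
    [f] takes the other value. *)
Definition ncross n (f : bvec n -> bool) (x : bvec n) : nat :=
  (\sum_p \sum_q cross f p q x)%N.

Lemma lap_ncross n (f : bvec n -> bool) x :
  lap setT (ind f) x = 2 * (2 * ind f x - 1) * (ncross f x)%:Z.
Proof.
have dE p q : diff p q (ind f) x =
    (2 * ind f x - 1) * ((cross f p q x : nat)%:Z + (cross f q p x : nat)%:Z).
  rewrite /cross [sw q p x]swC; case xp: (x p); case xq: (x q) => /=;
    rewrite ?addr0 ?add0r ?mulr0; first by rewrite diff_id ?xp ?xq.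
  - by rewrite /diff /ind; case: (f x); case: (f _).
  - by rewrite /diff /ind; case: (f x); case: (f _).
  - by rewrite diff_id ?xp ?xq.
have e : (ncross f x)%:Z = \sum_p \sum_q (cross f p q x : nat)%:Z.
  by rewrite Posz_sum; apply: eq_bigr => p _; rewrite Posz_sum.
have e' : (ncross f x)%:Z = \sum_p \sum_q (cross f q p x : nat)%:Z.
  by rewrite e exchange_big.
transitivity ((2 * ind f x - 1) * ((ncross f x)%:Z + (ncross f x)%:Z)); last by ring.
rewrite {1}e e' -big_split mulr_sumr /lap; apply: eq_big => [p|p _]; first by rewrite inE.
by rewrite -big_split mulr_sumr; apply: eq_big => [q|q _]; rewrite ?inE ?dE.
Qed.

(** At [w = 6] the left side of the last inequality is 288 and the right side at most 242; at
    [w = 5] these are 150 and 162, so the argument starts at 6. *)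
Lemma cubic_gt_square w p : (6 <= w)%N -> (4 * p <= (4 * w - 2) ^ 2)%N ->
  (w * (2 * w * (w - 2)) <= 2 * p)%N -> False.
Proof.
move=> /subnK <-; move: (w - 6)%N => k.
have -> : (k + 6 - 2 = k + 4)%N by lia.
have -> : (4 * (k + 6) - 2 = 4 * k + 22)%N by lia.
have k3 : (0 <= k * k * k)%N by [].
have k2 : (0 <= k * k)%N by [].
nia.
Qed.

Section Count.
Variables (w : nat) (f : bvec (2 * w) -> bool) (b c : nat).
Hypothesis w_ge4 : (4 <= w)%N.
Hypothesis bc_sum : (b + c = 4 * w - 2)%N.
Local Notation V := (Vtx (2 * w) w).
Hypothesis ncrossE : forall x, x \in V -> ncross f x = if f x then b else c.

Lemma lap_equitable x : x \in V ->
  lap setT (ind f) x = 2 * ((4 * w%:Z - 2) * ind f x - c%:Z).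
Proof.
by move=> Vx; rewrite lap_ncross ncrossE // /ind; case: (f x); lia.
Qed.

Lemma V_gt0 : 0 < #|V|%:Z :> int.
Proof.
have [||| x [Vx _ _]] := @slice_seq w [::] [::] => //.
by rewrite ltz_nat; apply/card_gt0P; exists x.
Qed.

(** The Laplacian has total sum 0, which fixes the density of [f] as [c / (4w - 2)]. *)
Lemma sum_ind : (4 * w%:Z - 2) * \sum_(x in V) ind f x = c%:Z * #|V|%:Z.
Proof.
have : \sum_(x in V) lap setT (ind f) x = 0.
  rewrite exchange_big big1 // => p _; rewrite exchange_big big1 // => q _.
  by rewrite sumrB sum_sw subrr.
rewrite (eq_bigr _ (fun x Vx => lap_equitable Vx)) -mulr_sumr sumrB -mulr_sumr.
rewrite sumr_const (mulrn_int c%:Z) => e; apply/eqP; rewrite -subr_eq0 [_ * #|V|%:Z]mulrC.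
by apply/eqP; apply: (@mulfI _ 2%:Z); rewrite // e.
Qed.

(** Summing [ncross] counts each crossing edge from both ends, and the density from [sum_ind] turns
    the total into a multiple of [b * c]. *)
Lemma sum_cross : (2 * w%:Z - 1) * \sum_i \sum_j \sum_(x in V) (cross f i j x : nat)%:Z =
  b%:Z * c%:Z * #|V|%:Z.
Proof.
have -> : \sum_i \sum_j \sum_(x in V) (cross f i j x : nat)%:Z =
    \sum_(x in V) ((b%:Z - c%:Z) * ind f x + c%:Z).
  transitivity (\sum_(x in V) (ncross f x)%:Z).
    rewrite (eq_bigr _ (fun i _ => exchange_big _ _ _ _ _ _)) exchange_big.
    by apply: eq_bigr => x _; rewrite Posz_sum; apply: eq_bigr => i _; rewrite Posz_sum.
  by apply: eq_bigr => x Vx; rewrite ncrossE // /ind; case: (f x); ring.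
have := sum_ind; rewrite big_split -mulr_sumr sumr_const (mulrn_int c%:Z) /=.
set A := \sum_(x in V) _; set N := #|V|%:Z => e.
have bcZ : b%:Z = 4 * w%:Z - 2 - c%:Z by lia.
apply: (@mulfI _ 2%:Z) => //.
transitivity ((b%:Z - c%:Z) * ((4 * w%:Z - 2) * A) + (4 * w%:Z - 2) * N * c%:Z); first by ring.
by rewrite e bcZ; ring.
Qed.

Definition swappable i j := [forall x in V, f (sw i j x) == f x].

Lemma swappableP i j : reflect (forall x, x \in V -> f (sw i j x) = f x) (swappable i j).
Proof.
by apply: (iffP forall_inP) => H x Vx; apply/eqP; [apply: H | rewrite H].
Qed.

Lemma label_swappable i j (v : 'I_(2 * w) -> int) :
    (forall x, x \in V -> x i -> x j = false ->
      2 * diff i j (ind f) x = \sum_k v k * chi x k) ->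
  \sum_k `|v k| = 0 -> swappable i j.
Proof.
move=> vE v0.
have {}v0 k : v k = 0.
  by have /(_ k isT)/normr0_eq0 := psumr_eq0P (fun k _ => normr_ge0 (v k)) v0.
have f_swap x : x \in V -> x i -> x j = false -> f (sw i j x) = f x.
  move=> Vx xi xj; have := vE x Vx xi xj; rewrite big1 => [|k _]; last by rewrite v0 mul0r.
  by rewrite /diff /ind; case: (f x); case: (f _).
apply/swappableP => x Vx.
case xi: (x i); case xj: (x j); try by rewrite sw_id ?xi ?xj.
  exact: f_swap.
by have := f_swap (sw i j x); rewrite sw_Vtx swL swR xi xj swK => ->.
Qed.

(** On the slice the squared label form is 4 where the swap changes [f] and 0 elsewhere, so
    [second_moment] counts crossings; [norm2_quarter] with [m = w - 1] supplies [t]. A zero label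
    makes the pair swappable, with [t = 0]. *)
Lemma edge_weight i j : exists t : nat,
  [/\ (2 * w%:Z - 3) * \sum_(x in V) (cross f i j x : nat)%:Z = #|slice10 i j|%:Z * t%:Z,
      (~~ swappable i j -> w - 2 <= t)%N & i = j -> t = 0%N].
Proof.
have [->|nij] := eqVneq i j.
  exists 0%N; rewrite big1 => [|x _]; last by rewrite /cross; case: (x j).
  rewrite !mulr0; split=> // /negP[]; apply/swappableP => x _; by rewrite sw_id.
have [v [[vi vj] v02 vE]] := label w_ge4 lap_equitable nij.
have e4 : 4 * \sum_(x in V) (cross f i j x : nat)%:Z =
    \sum_(x in slice10 i j) (\sum_k v k * chi x k) ^+ 2.
  rewrite sum_slice10 mulr_sumr; apply: eq_bigr => x Vx.
  rewrite /cross; case xi: (x i); case xj: (x j) => //=; rewrite ?mul0r ?mulr0 //.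
  by rewrite -vE // /diff /ind; case: (f x); case: (f _).
have := second_moment nij vi vj; rewrite -e4 => e.
have sq_sum : (2 * w%:Z - 2) = (w - 1)%N%:Z * 2 by lia.
case: v02 => v2.
  have /swappableP sij := label_swappable vE v2.
  exists 0%N; split=> //; last by rewrite (label_swappable vE v2).
  by rewrite big1 ?mulr0 // => x Vx; rewrite /cross sij // eqxx !andbF.
have [|t [le_t et]] := @norm2_quarter _ v (w - 1) _ v2; first by lia.
exists t; split; [| by lia | by move=> e'; rewrite e' eqxx in nij].
apply: (@mulfI _ 4%:Z) => //.
transitivity ((2 * w%:Z - 3) * (4 * \sum_(x in V) (cross f i j x : nat)%:Z)); first by ring.
by rewrite e sq_sum et; ring.
Qed.

(** Summing [edge_weight] over all pairs gives the total of [sum_cross]. All slices with [i != j]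
    have the size in [card_slice10]; on the diagonal [t = 0] makes the same formula hold. *)
Lemma weight_sum : exists t : 'I_(2 * w) -> 'I_(2 * w) -> nat,
  (w * \sum_i \sum_j t i j = 2 * (2 * w - 3) * (b * c))%N /\
  forall i j, (~~ swappable i j -> w - 2 <= t i j)%N.
Proof.
have [t tP] := fin_all_exists (fun i => fin_all_exists (edge_weight i)).
exists t; split; last by move=> i j; case: (tP i j).
have tE i j : 2 * (2 * w%:Z - 1) * ((2 * w%:Z - 3) * \sum_(x in V) (cross f i j x : nat)%:Z) =
    w%:Z * #|V|%:Z * (t i j)%:Z.
  have [-> _ t0] := tP i j; rewrite mulrA; have [ij|nij] := eqVneq i j.
    by rewrite t0 // !mulr0.
  by rewrite card_slice10.
have tot : 2 * (2 * w%:Z - 3) * (b%:Z * c%:Z * #|V|%:Z) =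
    w%:Z * #|V|%:Z * \sum_i \sum_j (t i j)%:Z.
  rewrite -sum_cross.
  transitivity (2 * (2 * w%:Z - 1) * ((2 * w%:Z - 3) *
     \sum_i \sum_j \sum_(x in V) (cross f i j x : nat)%:Z)); first by ring.
  rewrite !mulr_sumr; apply: eq_bigr => i _.
  rewrite !mulr_sumr; apply: eq_bigr => j _.
  exact: tE.
apply/eqP; rewrite -eqz_nat; apply/eqP.
apply: (@mulfI _ #|V|%:Z); first by rewrite gt_eqF // V_gt0.
rewrite !PoszM -subzn; last by lia.
have -> : (\sum_i \sum_j t i j)%N%:Z = \sum_i \sum_j (t i j)%:Z.
  by rewrite Posz_sum; apply: eq_bigr => i _; rewrite Posz_sum.
by rewrite mulrCA mulrA -tot !PoszM; ring.
Qed.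

Lemma swappable_refl : reflexive swappable.
Proof. by move=> i; apply/swappableP => x _; rewrite sw_id. Qed.

Lemma swappable_sym : symmetric swappable.
Proof. by move=> i j; rewrite /swappable; under eq_forallb => x do rewrite swC. Qed.

Lemma swappable_trans : transitive swappable.
Proof.
move=> j i k /swappableP ij /swappableP jk; apply/swappableP => x Vx.
have [<-|nik] := eqVneq i k; first by rewrite sw_id.
have [->|nij] := eqVneq i j; first exact: jk.
have [<-|njk] := eqVneq j k; first exact: ij.
suff -> : sw i k x = sw i j (sw j k (sw i j x)) by rewrite ij ?jk ?ij ?sw_Vtx.
by apply: sw_conj.
Qed.

Definition swap_class i := [set j | swappable i j].

(** If every class had at most three elements, each row of [t] would have at least [2w - 3] entries
    of size at least [w - 2]. This contradicts the bound on [b * c] by the arithmetic-geometric mean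
    inequality. *)
Lemma large_swap_class : (6 <= w)%N -> exists i, (4 <= #|swap_class i|)%N.
Proof.
move=> w6; apply/existsP; rewrite -[X in is_true X]negbK negb_exists.
apply/negP => /forallP small.
have [t [tsum tge]] := weight_sum.
have row i : ((2 * w - 3) * (w - 2) <= \sum_j t i j)%N.
  have := small i; rewrite -ltnNge => lt4.
  have := cardsC (swap_class i); rewrite card_ord => cC.
  apply: (@leq_trans (\sum_(j in ~: swap_class i) (w - 2))).
    by rewrite sum_nat_const leq_mul2r; apply/orP; right; lia.
  rewrite [X in (_ <= X)%N](bigID (mem (swap_class i))) /=; apply: leq_trans (leq_addl _ _).
  rewrite (eq_bigl (fun j => j \notin swap_class i)); last by move=> j; rewrite inE.
  by apply: leq_sum => j; rewrite inE => /tge.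
have : (2 * w * ((2 * w - 3) * (w - 2)) <= \sum_i \sum_j t i j)%N.
  by rewrite -{1}[(2 * w)%N]card_ord -sum_nat_const; apply: leq_sum => i _; exact: row.
move: tsum; set S := (\sum_i _)%N => tsum leS.
have := nat_AGM2 b c; rewrite bc_sum => -[bc_max _].
have {leS}: ((2 * w - 3) * (w * (2 * w * (w - 2))) <= (2 * w - 3) * (2 * (b * c)))%N.
  rewrite [leqRHS]mulnA [X in (X * (b * c))%N]mulnC -tsum.
  by apply: leq_trans (leq_mul (leqnn w) leS); rewrite leq_eqVlt; apply/orP; left; apply/eqP; ring.
rewrite leq_pmul2l; last by lia.
by move=> h; apply: (cubic_gt_square w6 bc_max h).
Qed.
End Count.

(** * The coordinates that matter *)

Lemma sum_chi_sw n (v : 'I_n -> int) k l (x : bvec n) :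
  \sum_m v m * chi x m - \sum_m v m * chi (sw k l x) m = (v k - v l) * (chi x k - chi x l).
Proof.
have [->|kl] := eqVneq k l; first by rewrite sw_id // subrr subrr mul0r.
rewrite -sumrB (bigD1 k) // (bigD1 l) 1?eq_sym //= big1 => [|m /andP[mk ml]]; last first.
  by rewrite /chi swD // subrr.
by rewrite /chi swL swR; ring.
Qed.

Lemma card_supp_le (I : finType) (v : I -> int) : #|[set k | v k != 0]|%:Z <= \sum_k `|v k|.
Proof.
rewrite -sum1dep_card Posz_sum big_mkcond; apply: ler_sum => k _.
by case: eqP => [->|] //=; lia.
Qed.

Lemma normz_ge1 (z : int) : z != 0 -> 1 <= `|z|.
Proof. lia. Qed.

Lemma sign_add_neq0 (s t : int) : 1 <= t -> s + (if s < 0 then -1 else 1) * t != 0.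
Proof. by case: ltrP; lia. Qed.

Section Structure.
Variables (w : nat) (f : bvec (2 * w) -> bool) (b c : nat).
Hypothesis w_ge6 : (6 <= w)%N.
Hypothesis bc_sum : (b + c = 4 * w - 2)%N.
Local Notation V := (Vtx (2 * w) w).
Hypothesis ncrossE : forall x, x \in V -> ncross f x = if f x then b else c.

Let w_ge4 : (4 <= w)%N. Proof. by apply: leq_trans w_ge6. Qed.

Variable r0 : 'I_(2 * w).
Let R := swap_class f r0.
Hypothesis R_ge4 : (4 <= #|R|)%N.

Let R_swap r s : r \in R -> s \in R -> swappable f r s.
Proof.
by rewrite !inE swappable_sym => rr; apply: swappable_trans.
Qed.

Let R_out i r : i \notin R -> r \in R -> ~~ swappable f i r.
Proof.
rewrite !inE => ir rr; apply: contra ir => ir.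
by apply: swappable_trans rr _; rewrite swappable_sym.
Qed.

Let ind_sw r s x : r \in R -> s \in R -> x \in V -> ind f (sw r s x) = ind f x.
Proof. by move=> Rr Rs Vx; rewrite /ind; have /swappableP-> := R_swap Rr Rs. Qed.

(** The label of the pair [i], [r0] is nonzero because that pair is not swappable. Invariance under
    swaps inside [R] makes it constant, hence zero, on [R], and lets every [r] in [R] replace
    [r0]. *)
Lemma outer_label i : i \notin R -> exists v : 'I_(2 * w) -> int,
  [/\ v i = 0, {in R, forall k, v k = 0}, \sum_k `|v k| = 2 &
      forall r x, r \in R -> x \in V -> x i -> x r = false ->
        2 * diff i r (ind f) x = \sum_k v k * chi x k].
Proof.
move=> Ri; have Rr0 : r0 \in R by rewrite inE swappable_refl.
have nir r : r \in R -> i != r by apply: contraTneq => <-.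
have [v [[vi vr0] v02 vE]] := label w_ge4 (lap_equitable w_ge4 bc_sum ncrossE) (nir _ Rr0).
have v2 : \sum_k `|v k| = 2.
  case: v02 => // /(label_swappable vE) sij.
  by have := R_out Ri Rr0; rewrite sij.
have v_const k l : k \in R :\ r0 -> l \in R :\ r0 -> v k = v l.
  move=> /setD1P[kr0 Rk] /setD1P[lr0 Rl]; have [->//|kl] := eqVneq k l.
  have [ik il ir0] := And3 (nir _ Rk) (nir _ Rl) (nir _ Rr0).
  have [||| x [Vx /and3P[xi xk _] /and3P[/negbTE xr0 /negbTE xl _]]] := @slice_seq w [:: i; k] [:: r0; l].
  - by rewrite /= !inE !negb_or !(eq_sym r0) !(eq_sym l) ir0 kr0 il kl.
  - by apply: leq_trans w_ge6.
  - by apply: leq_trans w_ge6.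
  have := sum_chi_sw v k l x.
  rewrite -!vE ?sw_Vtx ?swD // 1?eq_sym //.
  rewrite /diff sw_comm 1?(eq_sym r0) // !(@ind_sw k l) ?sw_Vtx //.
  rewrite /chi xk xl subrr => /esym/eqP.
  by rewrite mulf_eq0 subr_eq0 => /orP[/eqP|].
have vR : {in R, forall k, v k = 0}.
  move=> k Rk; have [->//|kr0] := eqVneq k r0.
  (* At least three equal integer coefficients within an l1-norm of 2 must be 0; this is what the
     bound 4 on the class is for. *)
  have : #|R :\ r0|%:Z * `|v k| <= 2.
    rewrite -v2 (bigID (mem (R :\ r0))) /= ler_wpDr ?sumr_ge0 //.
    rewrite (eq_bigr (fun=> `|v k|)) => [|l Rl]; last by rewrite (v_const l k) //; apply/setD1P.
    by rewrite sumr_const mulrn_int.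
  have : (3 <= #|R :\ r0|)%N by have := cardsD1 r0 R; rewrite Rr0; lia.
  case: (v k =P 0) => // /eqP vk; rewrite -lez_nat => h3 h2.
  have h1 := normz_ge1 vk.
  by have := le_trans (ler_pM (isT : 0 <= 3%:Z) (isT : 0 <= 1%:Z) h3 h1) h2.
exists v; split=> // r x Rr Vx xi xr.
have -> : diff i r (ind f) x = diff i r0 (ind f) (sw r0 r x).
  have [->|rr0] := eqVneq r r0; first by rewrite [sw r0 r0 x]sw_id.
  rewrite /diff (@ind_sw r0 r) //; congr (_ - _).
  rewrite [sw i r x]swC (@sw_conj _ r r0 i) ?(eq_sym _ i) ?nir // (@ind_sw r r0) ?sw_Vtx //.
  by rewrite (swC r0 i) (swC r r0).
rewrite vE ?sw_Vtx //.
- by apply/eqP; rewrite eq_sym -subr_eq0 sum_chi_sw !vR // subrr mul0r.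
- by rewrite swD ?nir.
- by rewrite swL.
Qed.

(** The disjoint swaps of [i] with [r] and of [j] with [s] commute, and their mixed second
    difference is read off from either label. *)
Lemma outer_sym i j (u v : 'I_(2 * w) -> int) : i \notin R -> j \notin R -> i != j ->
    {in R, forall k, u k = 0} -> {in R, forall k, v k = 0} ->
    (forall r x, r \in R -> x \in V -> x i -> x r = false ->
        2 * diff i r (ind f) x = \sum_k u k * chi x k) ->
    (forall r x, r \in R -> x \in V -> x j -> x r = false ->
        2 * diff j r (ind f) x = \sum_k v k * chi x k) ->
  u j = v i.
Proof.
move=> Ri Rj nij uR vR uE vE.
have [r [s [Rr Rs nrs]]] : exists r s, [/\ r \in R, s \in R & r != s].
  have /card_gt1P[r [s [Rr Rs nrs]]] : (1 < #|R|)%N by apply: leq_trans R_ge4.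
  by exists r, s.
have nR k l : k \notin R -> l \in R -> (k == l = false) * (l == k = false).
  by move=> Rk Rl; rewrite [l == k]eq_sym; split; apply: contraNF Rk => /eqP->.
have [[ir ri] [iS si]] := (nR i r Ri Rr, nR i s Ri Rs).
have [[jr rj] [js sj]] := (nR j r Rj Rr, nR j s Rj Rs).
have [||| x [Vx /and3P[xi xj _] /and3P[/negbTE xr /negbTE xs _]]] :=
    @slice_seq w [:: i; j] [:: r; s].
- by rewrite /= !in_cons !negb_or ri rj si sj.
- by apply: leq_trans w_ge6.
- by apply: leq_trans w_ge6.
have := sum_chi_sw u j s x; have := sum_chi_sw v i r x.
have [nji nsr] : j != i /\ s != r by rewrite ![_ == i]eq_sym ![_ == r]eq_sym.
rewrite -(uE r) // -(uE r) ?sw_Vtx ?swD ?ir ?iS ?rj // -(vE s) // -(vE s) ?sw_Vtx ?swD ?jr ?si //.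
rewrite /diff (@sw_comm _ j s i r) ?jr ?si // (uR s Rs) (vR r Rr) /chi xi xj xr xs.
rewrite !subr0 => e1 e2; apply: (@mulIf _ (1 - -1 : int)) => //.
by rewrite -e1 -e2; ring.
Qed.

(** Since [u j = 0], the difference along [i], [r] is the same before and after swapping [j] and
    [s]. If that swap changes the value of [f], a nonzero difference would have to change sign. *)
Lemma not_both_sensitive i j r s (u v : 'I_(2 * w) -> int) x :
    i \notin R -> j \notin R -> i != j -> r \in R -> s \in R -> r != s ->
    {in R, forall k, u k = 0} -> u j = 0 ->
    (forall r x, r \in R -> x \in V -> x i -> x r = false ->
        2 * diff i r (ind f) x = \sum_k u k * chi x k) ->
    (forall r x, r \in R -> x \in V -> x j -> x r = false ->
        2 * diff j r (ind f) x = \sum_k v k * chi x k) ->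
  x \in V -> x i -> x j -> x r = false -> x s = false ->
  \sum_k u k * chi x k != 0 -> \sum_k v k * chi x k != 0 -> False.
Proof.
move=> Ri Rj nij Rr Rs nrs uR uj uE vE Vx xi xj xr xs.
have nR k l : k \notin R -> l \in R -> (k == l = false) * (l == k = false).
  by move=> Rk Rl; rewrite [l == k]eq_sym; split; apply: contraNF Rk => /eqP->.
have [[ir ri] [iS si]] := (nR i r Ri Rr, nR i s Ri Rs).
have [[jr rj] [js sj]] := (nR j r Rj Rr, nR j s Rj Rs).
have := sum_chi_sw u j s x; rewrite (uR s Rs) uj subrr mul0r.
rewrite -(uE r) // -(vE s) // -(uE r) ?sw_Vtx ?swD ?iS ?rj //.
by rewrite /diff /ind; case: (f x); case: (f _); case: (f _); case: (f _).
Qed.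

(** A coordinate in the support of [u] but not of [v] can be oriented freely once the form of [v] is
    made nonzero. This makes [i] and [j] sensitive at one point, against [not_both_sensitive]. *)
Lemma supp_subset i j (u v : 'I_(2 * w) -> int) :
    i \notin R -> j \notin R -> i != j ->
    {in R, forall k, u k = 0} -> {in R, forall k, v k = 0} ->
    u i = 0 -> u j = 0 -> v i = 0 -> v j = 0 ->
    \sum_k `|u k| = 2 -> \sum_k `|v k| = 2 ->
    (forall r x, r \in R -> x \in V -> x i -> x r = false ->
        2 * diff i r (ind f) x = \sum_k u k * chi x k) ->
    (forall r x, r \in R -> x \in V -> x j -> x r = false ->
        2 * diff j r (ind f) x = \sum_k v k * chi x k) ->
  forall p, u p != 0 -> v p != 0.
Proof.
move=> Ri Rj nij uR vR ui uj vi vj u2 v2 uE vE p up; apply/negP => /eqP vp.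
have [r [s [Rr Rs nrs]]] : exists r s, [/\ r \in R, s \in R & r != s].
  have /card_gt1P[r [s [Rr Rs nrs]]] : (1 < #|R|)%N by apply: leq_trans R_ge4.
  by exists r, s.
(* Choose a point maximising the form [v], then orient the remaining support of
   [u] so that the form [u] does not vanish: both [i] and [j] are then sensitive. *)
pose sgb (z : int) (a : bool) : int := if a then z else - z.
have sgb_pos (z : int) : sgb z (0 < z) = `|z|.
  by rewrite /sgb; case: ltrP => z0; [rewrite gtr0_norm | rewrite ler0_norm].
pose sig := \sum_(k | v k != 0) sgb (u k) (0 < v k).
pose val k := if v k != 0 then 0 < v k else (0 < u k) (+) (sig < 0).
(* The two supports prescribe at most four values. With [i] and [j] as ones and [r] and [s] as
   zeros, at most six of each kind are prescribed, which [6 <= w] allows. *)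
pose U := [set k | u k != 0] :|: [set k | v k != 0].
have cU : (#|U| <= 4)%N.
  apply: leq_trans (leq_card_setU _ _) _.
  have := card_supp_le u; have := card_supp_le v; rewrite u2 v2 !lez_nat.
  by move=> *; apply: (@leq_add _ _ 2 2).
have leqUsub (P : pred 'I_(2 * w)) : (#|[set k in U | P k]| <= 4)%N.
  by apply: leq_trans cU; apply/subset_leq_card/subsetP => k /setIdP[].
have UN k : u k = 0 -> v k = 0 -> k \notin U by move=> uk vk; rewrite !inE uk vk eqxx.
have [Ui Uj Ur Us] := And4 (UN _ ui vi) (UN _ uj vj) (UN _ (uR _ Rr) (vR _ Rr)) (UN _ (uR _ Rs) (vR _ Rs)).
have [||| x [Vx xX xY]] := @slice_point (2 * w) w ([set i; j] :|: [set k in U | val k])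
    ([set r; s] :|: [set k in U | ~~ val k]).
- apply/pred0P => k /=; apply/negP => /andP[].
  case/setUP=> [/set2P[]->|/setIdP[Uk vk]]; case/setUP=> [/set2P[]kk|/setIdP[Uk' vk']].
  + by rewrite kk Rr in Ri.
  + by rewrite kk Rs in Ri.
  + by rewrite Uk' in Ui.
  + by rewrite kk Rr in Rj.
  + by rewrite kk Rs in Rj.
  + by rewrite Uk' in Uj.
  + by rewrite -kk Uk in Ur.
  + by rewrite -kk Uk in Us.
  + by rewrite vk in vk'.
- have [le1 _] := leq_card_setU [set i; j] [set k in U | val k].
  apply: leq_trans le1 _; rewrite cards2 nij.
  exact: leq_trans (leq_add (leqnn 2) (leqUsub val)) w_ge6.
- have [le1 _] := leq_card_setU [set r; s] [set k in U | ~~ val k].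
  apply: (@leq_trans (w + w)); last by rewrite mul2n addnn.
  rewrite leq_add2l; apply: leq_trans le1 _; rewrite cards2 nrs.
  exact: leq_trans (leq_add (leqnn 2) (leqUsub (predC val))) w_ge6.
have xi : x i by apply/xX/setUP; left; rewrite set21.
have xj : x j by apply/xX/setUP; left; rewrite set22.
have xr : x r = false by apply/xY/setUP; left; rewrite set21.
have xs : x s = false by apply/xY/setUP; left; rewrite set22.
have xU k : k \in U -> x k = val k.
  move=> Uk; case vk: (val k); first by apply/xX/setUP; right; apply/setIdP.
  by apply/xY/setUP; right; apply/setIdP; rewrite vk.
have chiE (z : int) k : k \in U -> z * chi x k = sgb z (val k).
  by move=> Uk; rewrite /chi xU // /sgb; case: ifP; rewrite ?mulr1 ?mulrN1.
apply: (not_both_sensitive Ri Rj nij Rr Rs nrs uR uj uE vE Vx xi xj xr xs).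
- rewrite (bigID (fun k => v k != 0)) /=.
  rewrite (eq_bigr (fun k => sgb (u k) (0 < v k))) => [|k vk]; last first.
    by rewrite chiE ?inE ?vk ?orbT // /val vk.
  rewrite -/sig (eq_bigr (fun k => (if sig < 0 then -1 else 1) * `|u k|)) => [|k]; last first.
    rewrite negbK => /eqP vk; have [->|uk] := eqVneq (u k) 0; first by rewrite normr0 mulr0 mul0r.
    rewrite chiE ?inE ?uk // /val vk eqxx /= -sgb_pos /sgb.
    by case: (0 < u k); case: (sig < 0) => /=; ring.
  rewrite -mulr_sumr.
  have : 1 <= \sum_(k | ~~ (v k != 0)) `|u k|.
    rewrite (bigD1 p) /= ?vp ?eqxx // -[1]addr0 lerD ?normz_ge1 //.
    exact: sumr_ge0.
  exact: sign_add_neq0.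
- suff -> : \sum_k v k * chi x k = 2 by [].
  rewrite -v2; apply: eq_bigr => k _; have [->|vk] := eqVneq (v k) 0.
    by rewrite normr0 mul0r.
  by rewrite chiE ?inE ?vk ?orbT // /val vk -sgb_pos.
Qed.

(** Take [k] in the support of [u i]. Any other outer [j] with [u i j = 0] has [k] in its support by
    [supp_subset], so [u k j] is nonzero by symmetry. Two supports of size at most 2 thus cover all
    outer coordinates. *)
Lemma card_outer : (#|~: R| <= 4)%N.
Proof.
have uP i : exists v : 'I_(2 * w) -> int, i \notin R ->
    [/\ v i = 0, {in R, forall k, v k = 0}, \sum_k `|v k| = 2 &
      forall r x, r \in R -> x \in V -> x i -> x r = false ->
        2 * diff i r (ind f) x = \sum_k v k * chi x k].
  have [Ri|Ri] := boolP (i \in R); first by exists (fun=> 0).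
  by have [v vP] := outer_label Ri; exists v.
have {uP}[u uP] := fin_all_exists uP.
have [RT|[i]] := set_0Vmem (~: R); first by rewrite RT cards0.
rewrite inE => Ri; have [ui uR u2 uE] := uP i Ri.
have usym k l : k \notin R -> l \notin R -> k != l -> u k l = u l k.
  move=> Rk Rl kl; have [_ kR _ kE] := uP k Rk; have [_ lR _ lE] := uP l Rl.
  exact: (outer_sym Rk Rl kl kR lR kE lE).
have [k uk] : exists k, u i k != 0.
  apply/existsP; rewrite -[X in is_true X]negbK negb_exists; apply/negP => /forallP u0.
  have : \sum_k `|u i k| = 0.
    by apply: big1 => k _; have := u0 k; rewrite negbK => /eqP->.
  by rewrite u2.
have Rk : k \notin R by apply: contra uk => /uR->.
have [uk0 kR k2 kE] := uP k Rk.
have ik : i != k by apply: contraNneq uk => <-; rewrite ui.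
apply: (@leq_trans #|[set l | u i l != 0] :|: [set l | u k l != 0]|); last first.
  apply: leq_trans (leq_card_setU _ _) _; apply: (@leq_add _ _ 2 2).
    by have := card_supp_le (u i); rewrite u2.
  by have := card_supp_le (u k); rewrite k2.
apply: subset_leq_card; apply/subsetP => j; rewrite in_setC => Rj; rewrite !inE.
have [uij|//] := eqVneq (u i j) 0; rewrite /=.
have [<-|nij] := eqVneq i j; first by rewrite usym // eq_sym.
have [uj jR j2 jE] := uP j Rj.
have uji : u j i = 0 by rewrite usym // eq_sym.
have := supp_subset Ri Rj nij uR jR ui uij uji uj u2 j2 uE jE uk => ujk.
have kj : k != j by apply: contraNneq uk => ->; rewrite uij.
by rewrite usym.
Qed.

End Structure.

Section Junta.
Variables (w : nat) (f : bvec (2 * w) -> bool) (b c : nat).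
Hypothesis w_ge6 : (6 <= w)%N.
Hypothesis bc_sum : (b + c = 4 * w - 2)%N.
Local Notation V := (Vtx (2 * w) w).
Hypothesis ncrossE : forall x, x \in V -> ncross f x = if f x then b else c.

Lemma junta : exists T : {set 'I_(2 * w)}, [/\ #|T| = 4%N,
    {in ~: T &, forall r s, swappable f r s} &
    {in T, forall i, exists v : 'I_(2 * w) -> int,
      [/\ v i = 0, forall k, k \notin T -> v k = 0 &
      forall r x, r \notin T -> x \in V -> x i -> x r = false ->
        2 * diff i r (ind f) x = \sum_k v k * chi x k]}].
Proof.
have w_ge4 : (4 <= w)%N by apply: leq_trans w_ge6.
have [r0 R4] := large_swap_class w_ge4 bc_sum ncrossE w_ge6.
have outer := card_outer w_ge6 bc_sum ncrossE R4.
(* A vector of weight 4 enlarges the outer set to exactly four coordinates. *)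
have [||| z [Vz zX _]] := @slice_point (2 * w) 4 (~: swap_class f r0) set0.
- by rewrite disjoint_sym disjoints_subset sub0set.
- exact: outer.
- by rewrite cards0; lia.
have RT r : z r = false -> r \in swap_class f r0.
  by move=> zr; apply: contraFT zr => rR; apply: zX; rewrite in_setC.
have swR2 r s : r \in swap_class f r0 -> s \in swap_class f r0 -> swappable f r s.
  by rewrite !inE [swappable f r0 r]swappable_sym => rr; apply: swappable_trans.
exists [set k | z k]; split.
- by move: Vz; rewrite inE => /eqP.
- by move=> r s; rewrite !in_setC !in_set => /negbTE/RT Rr /negbTE/RT Rs; exact: swR2.
move=> i _; have [Ri|Ri] := boolP (i \in swap_class f r0).
  (* A padding coordinate belongs to the class, so its differences vanish. *)
  exists (fun=> 0); split=> // r x; rewrite in_set => /negbTE/RT Rr Vx _ _.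
  rewrite big1 => [|k _]; last by rewrite mul0r.
  have /swappableP sir := swR2 _ _ Ri Rr.
  by rewrite /diff /ind sir // subrr.
have [v [vi vR _ vE]] := outer_label w_ge6 bc_sum ncrossE R4 Ri.
exists v; split=> //; first by move=> k; rewrite in_set => /negbTE/RT/vR.
by move=> r x; rewrite in_set => /negbTE/RT; exact: vE.
Qed.

End Junta.

(** * Even quadratic Boolean functions of four variables *)

Lemma perm_extend (T : finType) (us ts : seq T) : uniq us -> uniq ts ->
  size us = size ts -> exists s : {perm T}, map s us = ts.
Proof.
elim: us ts => [|u us IH] [|t ts] //=; first by exists 1%g.
move=> /andP[uus uu] /andP[tts ut] [/(IH _ uu ut)[s sts]].
exists (s * tperm (s u) t)%g; rewrite permM tpermL; congr (_ :: _).
rewrite -sts; apply/eq_in_map => v vus; rewrite permM tpermD //.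
  by rewrite (inj_eq perm_inj); apply: contraNneq uus => ->.
by apply: contraNneq tts => ->; rewrite -sts map_f.
Qed.

Lemma ord_seq n (l : seq nat) : all (ltn^~ n) l -> exists us : seq 'I_n, map val us = l.
Proof.
elim: l => [|k l IH] /=; first by exists [::].
by move=> /andP[kn /IH[us <-]]; exists (Ordinal kn :: us).
Qed.

Lemma coord_val n (x : bvec n) (i : 'I_n) : Defs.coord x (val i) = x i.
Proof.
apply/existsP/idP => [[j /andP[/eqP/val_inj->]]//|xi].
by exists i; rewrite eqxx.
Qed.

Fixpoint bitseqs (n : nat) : seq (seq bool) :=
  if n is m.+1 then [seq false :: s | s <- bitseqs m] ++ [seq true :: s | s <- bitseqs m]
  else [:: [::]].

Lemma mem_bitseqs n s : (s \in bitseqs n) = (size s == n).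
Proof.
elim: n s => [|n IH] [|a s] //=; rewrite mem_cat.
  by apply/negbTE; rewrite negb_or; apply/andP; split; apply/mapP => -[].
rewrite eqSS -IH; have inj (d : bool) : injective (cons d) by move=> s1 s2 [].
case: a; rewrite (mem_map (inj _)).
  by rewrite [X in X || _](_ : _ = false) //; apply/negbTE/mapP => -[].
by rewrite [X in _ || X](_ : _ = false) ?orbF //; apply/negbTE/mapP => -[].
Qed.

Definition upd (s : seq bool) a d := set_nth false s a d.

(* The signed terms are split over the two sides to stay in [nat]. *)
Definition third_diff0 (g : seq bool -> bool) a b c s : bool :=
  let h x y z := nat_of_bool (g (upd (upd (upd s a x) b y) c z)) in
  (h true true true + h true false false + h false true false + h false false true ==
   h false false false + h false true true + h true false true + h true true false)%N.

Definition q1 (s : seq bool) : bool := if s is [:: x; y; z] then (x != y) && (y == z) else false.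
Definition q2 (s : seq bool) : bool := if s is [:: x; y] then x == y else false.
(** [B3] is closed under flipping the fifth bit, so these eight prefixes of length four determine
    it. *)
Definition q3 (s : seq bool) : bool := s \in [:: [:: false; false; false; false]; [:: false; false; true; false];
  [:: false; false; false; true]; [:: true; false; true; false]; [:: false; true; false; true];
  [:: true; true; true; true]; [:: true; true; false; true]; [:: true; true; true; false]].
Definition q4 (s : seq bool) : bool := if s is [:: x; y; z] then (x == y) && (y == z) else false.

(* The first cell of P_k is [q_k] applied to the listed coordinates: for example
   the eight words of B1 are those with x1 <> x4 = x5. *)
Definition models : seq ((seq bool -> bool) * seq nat) :=
  [:: (q1, [:: 0; 3; 4]%N); (q2, [:: 0; 1]%N); (q3, [:: 0; 1; 2; 3]%N); (q4, [:: 0; 1; 2]%N)].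

(** Truncated permutations run through all injective choices of [k] of the four positions, possibly
    with repetition. *)
Definition selections (k : nat) : seq (seq nat) :=
  [seq take k s | s <- permutations [:: 0; 1; 2; 3]%N].

Definition matches (g : seq bool -> bool) (q : seq bool -> bool) (idx : seq nat) (e : bool) :=
  all (fun s => g s == e (+) q [seq nth false s i | i <- idx]) (bitseqs 4).

Definition classified g : bool :=
  [|| all (fun s => g s == true) (bitseqs 4), all (fun s => g s == false) (bitseqs 4) |
   has (fun m => has (fun idx => has (matches g m.1 idx) [:: true; false])
     (selections (size m.2))) models].

(* A function invariant under complementation is determined by its 8 values at the
   words starting with [false]. *)
Definition lookup8 (l : seq bool) (s : seq bool) : bool :=
  let: i := if s is [:: a; x; y; z] then
     (((x (+) a) * 2 + (y (+) a)) * 2 + (z (+) a))%N else 0%N in nth false l i.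

Definition third_diffs0 g : bool :=
  all (fun s => all (fun t => third_diff0 g t.1.1 t.1.2 t.2 s)
    [:: (0, 1, 2); (0, 1, 3); (0, 2, 3); (1, 2, 3)]%N) (bitseqs 4).

Lemma lookup8_classified :
  all (fun l => if third_diffs0 (lookup8 l) then classified (lookup8 l) else true) (bitseqs 8).
Proof. by vm_compute. Qed.

Lemma even_quadratic_classified g :
    (forall s, size s = 4%N -> g (map negb s) = g s) -> third_diffs0 g -> classified g.
Proof.
move=> geven.
pose l := [seq g (false :: s) | s <- bitseqs 3].
have gl s : s \in bitseqs 4 -> lookup8 l s = g s.
  rewrite mem_bitseqs; case: s => [|a [|x [|y [|z []]]]] // _.
  have e := geven [:: a; x; y; z] erefl.
  by move: e; case: a; case: x; case: y; case: z.
have third_ext (g1 g2 : seq bool -> bool) : {in bitseqs 4, g1 =1 g2} ->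
    third_diffs0 g1 = third_diffs0 g2.
  move=> e12; apply: eq_in_all => s; rewrite mem_bitseqs => s4.
  apply: eq_in_all => t t4; have sz a b c x y z : (a < 4)%N -> (b < 4)%N -> (c < 4)%N ->
      upd (upd (upd s a x) b y) c z \in bitseqs 4.
    move: s4 => /eqP s4; rewrite mem_bitseqs !size_set_nth s4 /maxn.
    by move=> a4 b4 c4; do !case: ifP; lia.
  rewrite /third_diff0.
  by move: t4; rewrite !inE => /or4P[]/eqP->; rewrite !e12 //; apply: sz.
have cl_ext (g1 g2 : seq bool -> bool) : {in bitseqs 4, g1 =1 g2} ->
    classified g1 = classified g2.
  move=> e12; rewrite /classified.
  congr [|| _, _ | _]; try by apply: eq_in_all => s /e12->.
  apply: eq_has => m; apply: eq_has => idx; apply: eq_has => e.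
  by apply: eq_in_all => s /e12->.
rewrite -(third_ext _ _ gl) -(cl_ext _ _ gl) => tl.
have := allP lookup8_classified l; rewrite mem_bitseqs tl; exact.
Qed.

(** * Reduction to four coordinates *)

Section Pattern.
Variables (w : nat) (f : bvec (2 * w) -> bool) (T : {set 'I_(2 * w)}).
Hypothesis w_ge6 : (6 <= w)%N.
Local Notation V := (Vtx (2 * w) w).
Hypothesis card_T : #|T| = 4%N.
Hypothesis swapT : {in ~: T &, forall r s, swappable f r s}.
Hypothesis labelT : {in T, forall i, exists v : 'I_(2 * w) -> int,
  [/\ v i = 0, forall k, k \notin T -> v k = 0 &
  forall r x, r \notin T -> x \in V -> x i -> x r = false ->
    2 * diff i r (ind f) x = \sum_k v k * chi x k]}.

Let ts := enum T.

Let size_ts : size ts = 4%N. Proof. by rewrite -cardE. Qed.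

(** By [sw_connect], points with the same pattern on [T] have the same value. Unattained patterns
    get the arbitrary value [true], words of wrong length [false]. *)
Lemma pattern_function : exists g : seq bool -> bool,
  forall x, x \in V -> f x = g [seq x t | t <- ts].
Proof.
have vP (v : 4.-tuple bool) : exists y, forall x, x \in V -> [seq x t | t <- ts] = v -> f x = y.
  pose P (x : bvec (2 * w)) := (x \in V) && ([seq x t | t <- ts] == v).
  have [x0 /andP[Vx0 /eqP e0]|no] := pickP P.
    exists (f x0) => x Vx ex.
    apply: (@sw_connect _ _ _ (~: T) V) => //.
    - by move=> y p q Vy _ _; rewrite sw_Vtx.
    - by move=> y p q Vy Tp Tq; have /swappableP-> := swapT Tp Tq.
    - by move: Vx Vx0; rewrite !inE => /eqP-> /eqP->.
    - move=> k; rewrite inE negbK => Tk.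
      by apply: (eq_in_map (fun t => x t) (fun t => x0 t) ts).2; rewrite ?ex ?e0 // mem_enum.
  by exists true => x Vx ex; have := no x; rewrite /P Vx ex eqxx.
have [y yP] := fin_all_exists vP.
exists (fun s => if insub s is Some v then y v else false) => x Vx.
have sz : size [seq x t | t <- ts] == 4%N by rewrite size_map size_ts.
by rewrite insubT; apply: yP.
Qed.

Lemma pattern_point r s : r \notin T -> size s = 4%N ->
  exists x, [/\ x \in V, [seq x t | t <- ts] = s & x r = false].
Proof.
move=> Tr s4; pose X := [set t in T | nth false s (index t ts)].
have leX (P : pred 'I_(2 * w)) : (#|[set t in T | P t]| <= 4)%N.
  by rewrite -card_T; apply/subset_leq_card/subsetP => k /setIdP[].
have [||| x [Vx xX xY]] := @slice_point (2 * w) w X (r |: [set t in T | ~~ nth false s (index t ts)]).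
- apply/pred0P => k /=; apply/negP => /andP[/setIdP[Tk sk] /setU1P[kr|/setIdP[_]]].
    by rewrite -kr Tk in Tr.
  by rewrite sk.
- by apply: leq_trans (leX _) _; apply: leq_trans w_ge6.
- apply: (@leq_trans (w + w)); last by rewrite mul2n addnn.
  rewrite leq_add2l cardsU1; apply: leq_trans (leq_add (leq_b1 _) (leX _)) _.
  by apply: leq_trans w_ge6.
exists x; split=> //; last by apply/xY/setU1P; left.
apply: (@eq_from_nth _ false); first by rewrite size_map size_ts s4.
rewrite size_map => q qs; have t0 : 'I_(2 * w) by exact: r.
rewrite (nth_map t0) //; have Tq : nth t0 ts q \in T by rewrite -mem_enum mem_nth.
have iq : index (nth t0 ts q) ts = q by rewrite index_uniq // enum_uniq.
case sq: (nth false s q); first by apply/xX/setIdP; rewrite iq.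
by apply/xY/setU1P; right; apply/setIdP; rewrite iq sq.
Qed.

Variable g : seq bool -> bool.
Hypothesis fE : forall x, x \in V -> f x = g [seq x t | t <- ts].

(** Swapping a one at position [p] of [T] with a zero outside [T] turns that bit off in the pattern,
    so labels become discrete derivatives of [g]. *)
Lemma position_label p : (p < 4)%N -> exists c : nat -> int, c p = 0 /\
  forall s, size s = 4%N ->
    2 * ((g (upd s p true) : nat)%:Z - (g (upd s p false) : nat)%:Z) =
      \sum_(q <- iota 0 4) c q * (if nth false s q then 1 else -1).
Proof.
move=> p4; have [r Tr] : exists r, r \notin T.
  apply/existsP; rewrite -[X in is_true X]negbK negb_exists; apply/negP => /forallP allT.
  have := cardsC T; rewrite card_T card_ord (_ : ~: T = set0) ?cards0; first by lia.
  by apply/setP => k; have := allT k; rewrite negbK !inE => ->.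
have ip : nth r ts p \in T by rewrite -mem_enum mem_nth // size_ts.
have [v [vi vT vE]] := labelT ip.
exists (fun q => v (nth r ts q)); split=> // s s4.
have s4' d : size (upd s p d) = 4%N by rewrite size_set_nth s4; apply/maxn_idPr.
have [x [Vx xs xr]] := pattern_point Tr (s4' true).
have x_nth q : (q < 4)%N -> x (nth r ts q) = nth false (upd s p true) q.
  by move=> q4; rewrite -xs (nth_map r) // size_ts.
have xp : x (nth r ts p) by rewrite x_nth // nth_set_nth /= eqxx.
have swx : [seq sw (nth r ts p) r x t | t <- ts] = upd s p false.
  apply: (@eq_from_nth _ false); first by rewrite size_map size_ts s4'.
  rewrite size_map size_ts => q q4; rewrite (nth_map r) ?size_ts // nth_set_nth /=.
  have [->|qp] := eqVneq q p; first by rewrite swL.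
  rewrite swD; first by rewrite x_nth // nth_set_nth /= (negbTE qp).
    by rewrite nth_uniq ?size_ts ?enum_uniq.
  by apply: contraNneq Tr => <-; rewrite -mem_enum mem_nth // size_ts.
have := vE r x Tr Vx xp xr.
have ind_nat y : ind f y = (f y : nat)%:Z by rewrite /ind; case: (f y).
rewrite /diff !ind_nat !fE ?sw_Vtx // xs swx => ->.
rewrite (bigID (mem T)) /= [X in _ + X]big1 => [|k Tk]; last by rewrite vT // mul0r.
rewrite addr0 -big_enum /= -/ts -[X in \sum_(k <- X) _](mkseq_nth r) size_ts big_map.
apply: eq_big_seq => q; rewrite mem_iota => /andP[_ q4].
rewrite /chi x_nth // nth_set_nth /=; have [->|//] := eqVneq q p.
by rewrite vi !mul0r.
Qed.

Lemma pattern_classified : classified g.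
Proof.
pose sg (d : bool) : int := if d then 1 else -1.
have e0 : exists c1 c2 c3, forall x y z,
    2 * ((g [:: true; x; y; z] : nat)%:Z - (g [:: false; x; y; z] : nat)%:Z) =
    c1 * sg x + c2 * sg y + c3 * sg z.
  have [//|c [c0 cE]] := @position_label 0; exists (c 1%N), (c 2%N), (c 3%N) => x y z.
  have := cE [:: true; x; y; z] erefl; rewrite /= !big_cons big_nil c0 /= => ->.
  by rewrite /sg; ring.
have e1 : exists c0 c2 c3, forall x y z,
    2 * ((g [:: x; true; y; z] : nat)%:Z - (g [:: x; false; y; z] : nat)%:Z) =
    c0 * sg x + c2 * sg y + c3 * sg z.
  have [//|c [c0 cE]] := @position_label 1; exists (c 0%N), (c 2%N), (c 3%N) => x y z.
  have := cE [:: x; true; y; z] erefl; rewrite /= !big_cons big_nil c0 /= => ->.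
  by rewrite /sg; ring.
have e2 : exists c0 c1 c3, forall x y z,
    2 * ((g [:: x; y; true; z] : nat)%:Z - (g [:: x; y; false; z] : nat)%:Z) =
    c0 * sg x + c1 * sg y + c3 * sg z.
  have [//|c [c0 cE]] := @position_label 2; exists (c 0%N), (c 1%N), (c 3%N) => x y z.
  have := cE [:: x; y; true; z] erefl; rewrite /= !big_cons big_nil c0 /= => ->.
  by rewrite /sg; ring.
have e3 : exists c0 c1 c2, forall x y z,
    2 * ((g [:: x; y; z; true] : nat)%:Z - (g [:: x; y; z; false] : nat)%:Z) =
    c0 * sg x + c1 * sg y + c2 * sg z.
  have [//|c [c0 cE]] := @position_label 3; exists (c 0%N), (c 1%N), (c 2%N) => x y z.
  have := cE [:: x; y; z; true] erefl; rewrite /= !big_cons big_nil c0 /= => ->.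
  by rewrite /sg; ring.
have sgN d : sg (~~ d) = - sg d by case: d.
(* A form without constant term changes sign under complementation, hence so does the derivative
   [h1 - h0]. *)
have odd_sum (h1 h0 : bool -> bool -> bool -> bool) :
    (exists c1 c2 c3, forall x y z, 2 * ((h1 x y z : nat)%:Z - (h0 x y z : nat)%:Z) =
      c1 * sg x + c2 * sg y + c3 * sg z) ->
    forall x y z, (h1 x y z + h1 (~~ x) (~~ y) (~~ z) = h0 x y z + h0 (~~ x) (~~ y) (~~ z))%N.
  move=> [c1 [c2 [c3 cE]]] x y z; have := cE x y z; have := cE (~~ x) (~~ y) (~~ z).
  rewrite !sgN !mulrN -!opprD => E1 E2; rewrite -E2 in E1.
  by move: E1; move: (h1 x y z) (h1 _ _ _) (h0 x y z) (h0 _ _ _) => [] [] [] [].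
(* Mixed second differences of a linear form vanish; applied to a derivative of [g] they are third
   differences of [g]. *)
have third h : (exists c1 c2 c3, forall x y z, h x y z = c1 * sg x + c2 * sg y + c3 * sg z) ->
    forall z, [/\ h true true z + h false false z = h true false z + h false true z,
      h true z true + h false z false = h true z false + h false z true &
      h z true true + h z false false = h z true false + h z false true].
  by move=> [c1 [c2 [c3 cE]]] z; rewrite !cE; split; ring.
(* By [odd_sum], [g s - g (map negb s)] does not change when one bit is flipped; flipping all four
   negates it, so it is 0. *)
apply: even_quadratic_classified.
  have o0 := odd_sum (fun x y z => g [:: true; x; y; z]) (fun x y z => g [:: false; x; y; z]) e0.
  have o1 := odd_sum (fun x y z => g [:: x; true; y; z]) (fun x y z => g [:: x; false; y; z]) e1.
  have o2 := odd_sum (fun x y z => g [:: x; y; true; z]) (fun x y z => g [:: x; y; false; z]) e2.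
  have o3 := odd_sum (fun x y z => g [:: x; y; z; true]) (fun x y z => g [:: x; y; z; false]) e3.
  move=> [|a [|x [|y [|z []]]]] // _.
  move: (o0 x y z) (o1 (~~ a) y z) (o2 (~~ a) (~~ x) z) (o3 (~~ a) (~~ x) (~~ y)).
  case: a; case: x; case: y; case: z => /= E0 E1 E2 E3; apply: (can_inj oddb); lia.
have t0 := third (fun x y z => 2 * ((g [:: true; x; y; z] : nat)%:Z -
  (g [:: false; x; y; z] : nat)%:Z)) e0.
have t1 := third (fun x y z => 2 * ((g [:: x; true; y; z] : nat)%:Z -
  (g [:: x; false; y; z] : nat)%:Z)) e1.
apply/allP => s; rewrite mem_bitseqs => s4; apply/allP => t.
case: s s4 => [|a [|x [|y [|z []]]]] // _.
rewrite !inE => /or4P[] /eqP -> /=; rewrite /third_diff0 /upd /=.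
- by have [h _ _] := t0 z; lia.
- by have [_ h _] := t0 y; lia.
- by have [_ _ h] := t0 x; lia.
- by have [_ _ h] := t1 a; lia.
Qed.

End Pattern.

(** * Neighbours in the Johnson graph *)

(** All ones of [x] are interchangeable, so for a fixed zero [q] either all [w] of them or none give
    a crossing edge. *)
Lemma ncross_dvd w (f : bvec (2 * w) -> bool) (T : {set 'I_(2 * w)}) x : (0 < w)%N ->
    {in ~: T &, forall r s, swappable f r s} -> x \in Vtx (2 * w) w ->
    (forall p, x p -> p \notin T) ->
  (w %| ncross f x)%N.
Proof.
move=> w0 swT Vx xT; have wx : wt x = w by move: Vx; rewrite inE => /eqP.
have [p0 xp0] : exists p, x p.
  apply/existsP; rewrite -[X in is_true X]negbK negb_exists; apply/negP => /forallP x0.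
  by move: w0; rewrite -wx -wt_sum big1 // => p _; rewrite (negbTE (x0 p)).
rewrite /ncross exchange_big; apply: dvdn_sum => q _.
rewrite (eq_bigr (fun p => x p * cross f p0 q x)%N) => [|p _].
  by rewrite -big_distrl /= wt_sum wx dvdn_mulr.
rewrite /cross xp0; case xp: (x p) => //=; case xq: (x q) => //=.
rewrite mul1n; congr (nat_of_bool (_ != _)).
have [->//|pp0] := eqVneq p p0.
have [pq p0q] : p != q /\ p0 != q by split; [apply: contraFneq xq => <- | apply: contraFneq xq => <-].
rewrite (@sw_conj _ p p0 q) // (@sw_id _ p p0 x) ?xp ?xp0 //.
have /swappableP-> // : swappable f p p0 by apply: swT; rewrite inE xT.
by rewrite sw_Vtx.
Qed.

Lemma adjJP n w (x y : bvec n) : (0 < w)%N -> x \in Vtx n w ->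
  reflect (exists p q, [/\ x p, ~~ x q & y = sw p q x]) (adjJ w x y).
Proof.
move=> w0 Vx; have wx : wt x = w by move: Vx; rewrite inE => /eqP.
apply: (iffP and3P) => [[_ /eqP wy /eqP wxy]|[p [q [xp xq ->]]]]; last first.
  split; rewrite ?wt_permx ?wx //.
  have -> : [set i | x i && sw p q x i] = [set i | x i] :\ p.
    apply/setP => k; rewrite !inE swE; case: tpermP => [->|->|/eqP kp _].
    - by rewrite (negbTE xq) andbF eqxx.
    - by rewrite (negbTE xq) andbF.
    - by rewrite kp andbb.
  by have := cardsD1 p [set i | x i]; rewrite inE xp -/(wt x) wx; lia.
pose X := [set i | x i]; pose Y := [set i | y i].
have XY : #|X :&: Y| = w.-1.
  by rewrite -wxy; apply: eq_card => k; rewrite !inE.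
have /eqP/cards1P[p pE] : #|X :\: Y| = 1%N.
  by rewrite cardsD XY -/(wt x) wx; lia.
have /eqP/cards1P[q qE] : #|Y :\: X| = 1%N.
  by rewrite cardsD setIC XY -/(wt y) wy; lia.
have /setDP[] : p \in X :\: Y by rewrite pE set11.
have /setDP[] : q \in Y :\: X by rewrite qE set11.
rewrite !inE => yq xq xp yp; exists p, q; split=> //; apply/ffunP => k; rewrite swE.
case: tpermP => [->|->|kp kq]; rewrite ?xp ?yq ?(negbTE xq) ?(negbTE yp) //.
move/setP/(_ k): pE; move/setP/(_ k): qE; rewrite !inE.
by move/eqP/negbTE: kp => ->; move/eqP/negbTE: kq => ->; case: (x k); case: (y k).
Qed.

Lemma card_neighbours n w (P : {set bvec n}) x : (0 < w)%N -> x \in Vtx n w ->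
  #|[set y in P | adjJ w x y]| = (\sum_p \sum_q [&& x p, ~~ x q & sw p q x \in P])%N.
Proof.
move=> w0 Vx; pose D := [set e : 'I_n * 'I_n | [&& x e.1, ~~ x e.2 & sw e.1 e.2 x \in P]].
have -> : [set y in P | adjJ w x y] = [set sw e.1 e.2 x | e in D].
  apply/setP => y; rewrite inE; apply/andP/imsetP.
    by move=> [Py /(adjJP _ w0 Vx)[p [q [xp xq yE]]]]; exists (p, q); rewrite // inE /= xp xq -yE.
  move=> [[p q]]; rewrite inE /= => /and3P[xp xq Pe] ->; split=> //.
  by apply/(adjJP _ w0 Vx); exists p, q.
rewrite card_in_imset => [|[p q] [p' q']]; last first.
  rewrite !inE /= => /and3P[xp xq _] /and3P[xp' xq' _] e.
  have pp : p = p'.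
    apply/eqP; apply: contraTT (xp) => pp'.
    have pq' : p != q' by apply: contraNneq xq' => <-.
    by rewrite -(swD x pp' pq') -e swL.
  congr (_, _) => //; apply/eqP; apply: contraNT (xq) => qq'.
  have qp' : q != p' by rewrite -pp; apply: contraTneq (xp) => <-.
  by rewrite -(swD x qp' qq') -e swR.
rewrite -sum1dep_card big_mkcond pair_bigA /=; apply: eq_bigr => e _.
by case: ifP.
Qed.

(** Both rows sum to [w^2], which differs from [lam2 w], so the entries of a left eigenvector sum to
    0. Then [lam2 w] is [S ord0 ord0 - S ord_max ord0], and the off-diagonal sum is
    [w^2 - lam2 w]. *)
Lemma quotient_offdiag w (S : 'M[nat]_2) : (4 <= w)%N ->
    (S ord0 ord0 + S ord0 ord_max = w * w)%N -> (S ord_max ord0 + S ord_max ord_max = w * w)%N ->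
    eigenvalue (map_mx (fun k : nat => k%:R : rat) S) (lam2 w) ->
  (S ord0 ord_max + S ord_max ord0 = 4 * w - 2)%N.
Proof.
move=> w4 row0 row1 /eigenvalueP[v vS v0].
have ordE : lift ord0 ord0 = ord_max :> 'I_2 by apply: val_inj.
have entry j : v ord0 ord0 * (S ord0 j)%:R + v ord0 ord_max * (S ord_max j)%:R =
    lam2 w * v ord0 j.
  have := congr1 (fun u : 'rV_2 => u ord0 j) vS; rewrite !mxE => <-.
  by rewrite big_ord_recl big_ord1 !mxE ordE.
have E0 := entry ord0; have E1 := entry ord_max.
have lamE : lam2 w = w%:R * w%:R - 4 * w%:R + 2.
  by rewrite /lam2 rmorphB rmorphXn rmorphB /= -!pmulrn; ring.
have R0 : (S ord0 ord0)%:R + (S ord0 ord_max)%:R = w%:R * w%:R :> rat by rewrite -natrD row0 natrM.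
have R1 : (S ord_max ord0)%:R + (S ord_max ord_max)%:R = w%:R * w%:R :> rat by rewrite -natrD row1 natrM.
have w4r : 4 <= w%:R :> rat by rewrite ler_nat.
have sum0 : v ord0 ord0 + v ord0 ord_max = 0.
  have : (v ord0 ord0 + v ord0 ord_max) * (4 * w%:R - 2) = 0.
    transitivity ((v ord0 ord0 * ((S ord0 ord0)%:R + (S ord0 ord_max)%:R) +
      v ord0 ord_max * ((S ord_max ord0)%:R + (S ord_max ord_max)%:R)) -
      lam2 w * (v ord0 ord0 + v ord0 ord_max)); first by rewrite R0 R1 lamE; ring.
    by rewrite [X in _ - X]mulrDr -E0 -E1; ring.
  by move=> /eqP; rewrite mulf_eq0 => /orP[/eqP//|/eqP]; lra.
have v1 : v ord0 ord_max = - v ord0 ord0 by apply/eqP; rewrite -addr_eq0 addrC sum0.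
have v00 : v ord0 ord0 != 0.
  apply: contra v0 => /eqP v00; apply/eqP/rowP => j; rewrite mxE.
  have [->|] : j = ord0 \/ j = ord_max.
    by case: j => [[|[|//]] jlt]; [left | right]; apply: val_inj.
  - exact: v00.
  - by move=> ->; rewrite v1 v00 oppr0.
have diag : (S ord0 ord0)%:R - (S ord_max ord0)%:R = lam2 w :> rat.
  apply: (mulfI v00); rewrite [RHS]mulrC -E0 v1; ring.
apply/eqP; rewrite -(eqr_nat rat) natrD natrB; last by lia.
by rewrite natrM; apply/eqP; lra.
Qed.

Lemma sum_ones_zeros n w (x : bvec n) : x \in Vtx n w ->
  (\sum_p \sum_q (x p && ~~ x q))%N = (w * (n - w))%N.
Proof.
rewrite inE => /eqP wx.
have -> : (n - w = \sum_q ~~ x q)%N.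
  apply: (@addIn w); rewrite subnK; last first.
    by rewrite -wx /wt -[leqRHS]card_ord max_card.
  rewrite -{1}wx -wt_sum -big_split /= (eq_bigr (fun=> 1%N)) => [|k _]; last by case: (x k).
  by rewrite sum1_card card_ord.
rewrite -{1}wx -wt_sum big_distrl /=; apply: eq_bigr => p _.
by rewrite big_distrr /=; apply: eq_bigr => q _; case: (x p); case: (x q).
Qed.

Section Equitable.
Variables (w : nat) (C1 : {set bvec (2 * w)}) (S : 'M[nat]_2).
Hypothesis w_ge4 : (4 <= w)%N.
Hypothesis eqC : equitable2 w C1 S.
Local Notation V := (Vtx (2 * w) w).

Let w0 : (0 < w)%N. Proof. by apply: leq_trans w_ge4. Qed.

Let ord_max_neq0 : (ord_max == ord0 :> 'I_2) = false. Proof. by []. Qed.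

Let in_cell1 x : (x \in cell w C1 ord_max) = (x \in V) && (x \notin C1).
Proof. by rewrite /cell ord_max_neq0 in_setD andbC. Qed.

Let cellE i j x : x \in cell w C1 i ->
  (\sum_p \sum_q [&& x p, ~~ x q & sw p q x \in cell w C1 j])%N = S i j.
Proof.
move=> xi; have [/subsetP sub _ _ e] := eqC; rewrite -(e i j x xi) card_neighbours //.
move: xi; rewrite /cell; case: ifP => _; first exact: sub.
by rewrite in_setD => /andP[].
Qed.

Lemma row_sum i : (S i ord0 + S i ord_max = w * w)%N.
Proof.
have [/subsetP sub /set0Pn[x0 C1x0] /set0Pn[x1 Cx1] _] := eqC.
have [x xi] : exists x, x \in cell w C1 i.
  by rewrite /cell; case: ifP => _; [exists x0 | exists x1].
have Vx : x \in V.
  by move: xi; rewrite /cell; case: ifP => _; [exact: sub | rewrite in_setD => /andP[]].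
have -> : (w * w = w * (2 * w - w))%N by rewrite mul2n -addnn addnK.
rewrite -(sum_ones_zeros Vx).
rewrite -!(cellE _ xi) -big_split; apply: eq_bigr => p _.
rewrite -big_split; apply: eq_bigr => q _ /=.
rewrite in_cell1 sw_Vtx Vx /=.
by rewrite {1}/cell eqxx; case: (x p); case: (x q); case: (_ \in C1).
Qed.

Lemma ncross_equitable x : x \in V ->
  ncross (fun y => y \in C1) x = if x \in C1 then S ord0 ord_max else S ord_max ord0.
Proof.
move=> Vx; rewrite /ncross; case: ifP => xC.
  have xi : x \in cell w C1 ord0 by rewrite /cell eqxx.
  rewrite -(cellE _ xi); apply: eq_bigr => p _; apply: eq_bigr => q _.
  by rewrite /cross in_cell1 sw_Vtx Vx xC /=; case: (_ \in C1).
have xi : x \in cell w C1 ord_max by rewrite in_cell1 Vx xC.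
rewrite -(cellE _ xi); apply: eq_bigr => p _; apply: eq_bigr => q _.
by rewrite /cross /cell eqxx xC; case: (_ \in C1).
Qed.

End Equitable.

(** * The classification *)

Lemma P1E w x : (x \in P1 w) =
  (x \in Vtx (2 * w) w) && q1 [seq Defs.coord x k | k <- [:: 0; 3; 4]%N].
Proof.
rewrite [x \in P1 w]in_set; congr (_ && _); rewrite /Defs.prefix /=.
by move: (Defs.coord x 0) (Defs.coord x 1) (Defs.coord x 2) (Defs.coord x 3) (Defs.coord x 4) => [] [] [] [] [].
Qed.

Lemma P2E w x : (x \in P2 w) =
  (x \in Vtx (2 * w) w) && q2 [seq Defs.coord x k | k <- [:: 0; 1]%N].
Proof.
rewrite [x \in P2 w]in_set; congr (_ && _) => /=.
by move: (Defs.coord x 0) (Defs.coord x 1) => [] [].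
Qed.

Lemma P3E w x : (x \in P3 w) =
  (x \in Vtx (2 * w) w) && q3 [seq Defs.coord x k | k <- [:: 0; 1; 2; 3]%N].
Proof.
rewrite [x \in P3 w]in_set; congr (_ && _); rewrite /Defs.prefix /=.
by move: (Defs.coord x 0) (Defs.coord x 1) (Defs.coord x 2) (Defs.coord x 3) (Defs.coord x 4) => [] [] [] [] [].
Qed.

Lemma P4E w x : (x \in P4 w) =
  (x \in Vtx (2 * w) w) && q4 [seq Defs.coord x k | k <- [:: 0; 1; 2]%N].
Proof.
rewrite [x \in P4 w]in_set; congr (_ && _); rewrite /Defs.prefix /=.
by move: (Defs.coord x 0) (Defs.coord x 1) (Defs.coord x 2) => [] [] [].
Qed.

(** A permutation carrying the listed coordinates to [ts] gives the equivalence; [e] decides between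
    the model and its complement. *)
Lemma equiv_part_model w (C1 D : {set bvec (2 * w)}) (q : seq bool -> bool) (l : seq nat)
    (ts : seq 'I_(2 * w)) (e : bool) :
    all (ltn^~ (2 * w)%N) l -> uniq l -> uniq ts -> size l = size ts ->
    (forall x, (x \in D) = (x \in Vtx (2 * w) w) && q [seq Defs.coord x k | k <- l]) ->
    (forall x, x \in Vtx (2 * w) w -> (x \in C1) = e (+) q [seq x t | t <- ts]) ->
  equiv_part w C1 D.
Proof.
move=> /ord_seq[us usl] ul uts szl DE CE.
have [||s sts] := @perm_extend _ us ts _ uts; first by rewrite -(map_inj_uniq val_inj) usl.
  by rewrite -szl -usl size_map.
have qE x : q [seq Defs.coord (permx s x) k | k <- l] = q [seq x t | t <- ts].
  rewrite -usl -sts -!map_comp; congr q; apply: eq_map => u /=.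
  by rewrite coord_val ffunE.
case: e CE => CE; [right | left]; exists s => x Vx.
  by rewrite in_setD DE permx_Vtx Vx qE CE //= andbT.
by rewrite DE permx_Vtx Vx qE CE.
Qed.

Lemma selections_uniq k : (k < 5)%N ->
  all (fun idx => [&& uniq idx, all (ltn^~ 4) idx & size idx == k]) (selections k).
Proof. by move: k => [|[|[|[|[|]]]]] //; vm_compute. Qed.

Lemma classification w (C1 : {set bvec (2 * w)}) (S : 'M[nat]_2) : (6 <= w)%N ->
    equitable2 w C1 S -> (S ord0 ord_max + S ord_max ord0 = 4 * w - 2)%N ->
  [\/ equiv_part w C1 (P1 w), equiv_part w C1 (P2 w),
      equiv_part w C1 (P3 w) | equiv_part w C1 (P4 w)].
Proof.
move=> w6 eqC bc; have w4 : (4 <= w)%N by apply: leq_trans w6.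
have [T [T4 swT labT]] := junta w6 bc (ncross_equitable w4 eqC).
have [g gE] := pattern_function T4 swT.
have [/subsetP sub /set0Pn[x0 C1x0] /set0Pn[x1]] := eqC.
rewrite in_setD => /andP[Cx1 Vx1] _; have Vx0 := sub _ C1x0.
have ts4 x : [seq x t | t <- enum T] \in bitseqs 4 by rewrite mem_bitseqs size_map -cardE T4.
have t0 : 'I_(2 * w) by exists 0%N; lia.
have model q l (D : {set bvec (2 * w)}) : (size l < 5)%N -> all (ltn^~ (2 * w)%N) l -> uniq l ->
    (forall x, (x \in D) = (x \in Vtx (2 * w) w) && q [seq Defs.coord x k | k <- l]) ->
    has (fun idx => has (matches g q idx) [:: true; false]) (selections (size l)) ->
  equiv_part w C1 D.
  move=> l5 ll ul DE /hasP[idx idxl /hasP[e _ /allP qE]].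
  have /and3P[uidx /allP idx4 /eqP szidx] := allP (selections_uniq l5) _ idxl.
  apply: (@equiv_part_model _ _ _ q l [seq nth t0 (enum T) i | i <- idx] e) => //.
  - rewrite map_inj_in_uniq // => i j /idx4 i4 /idx4 j4 /eqP.
    by rewrite nth_uniq ?enum_uniq -?cardE ?T4 // => /eqP.
  - by rewrite size_map.
  move=> x Vx; rewrite gE // (eqP (qE _ (ts4 x))) -map_comp; congr (_ (+) q _).
  by apply/eq_in_map => i /idx4 i4; rewrite /= (nth_map t0) // -cardE T4.
have lt5 k : (k < 5)%N -> (k < 2 * w)%N by lia.
case/or3P: (pattern_classified w6 T4 labT gE) => [/allP cst|/allP cst|].
- by move: (gE _ Vx1); rewrite (eqP (cst _ (ts4 x1))) (negbTE Cx1).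
- by move: (gE _ Vx0); rewrite (eqP (cst _ (ts4 x0))) C1x0.
case/or4P => [h|h|h|/orP[h|//]].
- by apply: Or41; apply: model (@P1E w) h; rewrite //= !lt5.
- by apply: Or42; apply: model (@P2E w) h; rewrite //= !lt5.
- by apply: Or43; apply: model (@P3E w) h; rewrite //= !lt5.
- by apply: Or44; apply: model (@P4E w) h; rewrite //= !lt5.
Qed.

(** Both cells are nonempty, so the density [c / (4w - 2)] lies strictly between 0 and 1. *)
Lemma offdiag_gt0 w (C1 : {set bvec (2 * w)}) (S : 'M[nat]_2) : (4 <= w)%N ->
    equitable2 w C1 S -> (S ord0 ord_max + S ord_max ord0 = 4 * w - 2)%N ->
  (0 < S ord0 ord_max)%N /\ (0 < S ord_max ord0)%N.
Proof.
move=> w4 eqC bc.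
have [/subsetP sub /set0Pn[x0 C1x0] /set0Pn[x1]] := eqC.
rewrite in_setD => /andP[Cx1 Vx1] _; have Vx0 := sub _ C1x0.
have := sum_ind w4 bc (ncross_equitable w4 eqC).
set F := ind _; set A := \sum_(x in _) _.
have F01 x : 0 <= F x <= 1 by rewrite /F /ind; case: ifP.
have A_ge1 : 1 <= A.
  rewrite /A (bigD1 x0) //= {1}/F /ind C1x0 lerDl; apply: sumr_ge0 => x _.
  by have /andP[] := F01 x.
have A_lt : A + 1 <= #|Vtx (2 * w) w|%:Z.
  rewrite -sum1_card Posz_sum /A [X in X + 1](bigD1 x1) //= [leRHS](bigD1 x1) //=.
  have -> : F x1 = 0 by rewrite /F /ind (negbTE Cx1).
  rewrite add0r addrC; apply: lerD => //; apply: ler_sum => x _.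
  by have /andP[] := F01 x.
move: A_ge1 A_lt; set N := #|_|%:Z => A1 AN e.
split; rewrite lt0n; apply/eqP => s0.
  have c_eq : (S ord_max ord0)%:Z = 4 * w%:Z - 2 by lia.
  have : A = N by apply: (@mulfI _ (4 * w%:Z - 2)); [apply/eqP; lia | rewrite e c_eq].
  by move=> h; move: AN; rewrite h; lia.
move: e; rewrite s0 mul0r => /eqP; rewrite mulf_eq0 => /orP[]/eqP h; first by lia.
by rewrite h in A1.
Qed.

Lemma small_offdiag w (C1 : {set bvec (2 * w)}) (S : 'M[nat]_2) : (4 <= w <= 6)%N ->
    equitable2 w C1 S -> (S ord0 ord_max + S ord_max ord0 = 4 * w - 2)%N ->
  exists2 m, m \in [:: w; 2 * w - 2; w - 2]%N &
    (minn (S ord0 ord_max) (S ord_max ord0) = m)%N.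
Proof.
move=> w46 eqC bc; have w4 : (4 <= w)%N by case/andP: w46.
have [b0 c0] := offdiag_gt0 w4 eqC bc.
have ncE := ncross_equitable w4 eqC.
have [t [tE _]] := weight_sum w4 bc ncE.
have [w5|w6] : (w < 6 \/ 6 <= w)%N by lia.
  move: tE bc b0 c0; set s := (\sum_i _)%N; move: (S ord0 ord_max) (S ord_max ord0) => b c tE bc b0 c0.
  exists (minn b c) => //; rewrite !inE.
  (* By [weight_sum], 4 divides [10 * b * c] with [b + c = 14], respectively 5 divides [14 * b * c]
     with [b + c = 18]; the few possibilities are enumerated. *)
  have [w_eq|w_eq] : w = 4%N \/ w = 5%N by lia.
    rewrite w_eq in tE bc *; have {}bc : b = (14 - c)%N by lia.
    have : (c < 14)%N by lia.
    move: c0 tE; rewrite bc {bc b0 b}.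
    by do 14![case: c => [|c] //=; try lia].
  rewrite w_eq in tE bc *; have {}bc : b = (18 - c)%N by lia.
  have : (c < 18)%N by lia.
  move: c0 tE; rewrite bc {bc b0 b}.
  by do 18![case: c => [|c] //=; try lia].
have [T [T4 swT _]] := junta w6 bc ncE.
(* For [w = 6], a vertex vanishing on [T] makes one off-diagonal entry divisible by 6, and the two
   entries sum to 22. *)
have [||| x [Vx _ xT]] := @slice_point (2 * w) w set0 T.
- by rewrite disjoints_subset sub0set.
- by rewrite cards0.
- by rewrite T4; lia.
have w0 : (0 < w)%N by apply: leq_trans w6.
have dv : (w %| if x \in C1 then S ord0 ord_max else S ord_max ord0)%N.
  rewrite -ncE //; apply: (ncross_dvd w0 swT Vx) => p xp.
  by apply: contraTN xp => /xT->.
have w_eq : w = 6%N by lia.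
exists (minn (S ord0 ord_max) (S ord_max ord0)) => //.
move: dv bc b0 c0; move: (S ord0 ord_max) (S ord_max ord0) => b c.
by case: (x \in C1); rewrite w_eq !inE => /dvdnP[k ->]; lia.
Qed.

Lemma listed_mx_min w (S : 'M[nat]_2) : (4 <= w <= 6)%N ->
    (S ord0 ord0 + S ord0 ord_max = w * w)%N -> (S ord_max ord0 + S ord_max ord_max = w * w)%N ->
    (S ord0 ord_max + S ord_max ord0 = 4 * w - 2)%N ->
    S ord_max ord0 \in [:: w; 2 * w - 2; w - 2]%N ->
  listed_mx w S.
Proof.
rewrite /listed_mx /is_mx22 !inE => w46.
move: (S ord0 ord0) (S ord0 ord_max) (S ord_max ord0) (S ord_max ord_max) => a b c d.
have [->|[->|->]] : w = 4%N \/ w = 5%N \/ w = 6%N by lia.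
all: move=> /= ab cd bc /or3P[] /eqP c_eq; rewrite c_eq in bc cd.
all: by apply/or3P; first [apply: Or31; apply/and4P; split; apply/eqP; lia
  | apply: Or32; apply/and4P; split; apply/eqP; lia
  | apply: Or33; apply/and4P; split; apply/eqP; lia].
Qed.

Theorem theorem3 (w : nat) (C1 : {set bvec (2 * w)}) (S : 'M[nat]_2) :
  (4 <= w)%N ->
  equitable2 w C1 S ->
  eigenvalue (map_mx (fun k : nat => (k%:R : rat)%R) S) (lam2 w) ->
  ((7 <= w)%N ->
     [\/ equiv_part w C1 (P1 w), equiv_part w C1 (P2 w),
         equiv_part w C1 (P3 w) | equiv_part w C1 (P4 w)]) /\
  ((w <= 6)%N ->
     ((S ord_max ord0 <= S ord0 ord_max)%N && listed_mx w S) \/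
     ((S ord0 ord_max <= S ord_max ord0)%N && listed_mx w (swap_mx S))).
Proof.
move=> w4 eqC eigS.
have row0 := row_sum w4 eqC ord0; have row1 := row_sum w4 eqC ord_max.
have bc := quotient_offdiag w4 row0 row1 eigS.
split=> [w7|w6]; first by apply: classification eqC bc; apply: leq_trans w7.
have w46 : (4 <= w <= 6)%N by rewrite w4.
have [m m_in minE] := small_offdiag w46 eqC bc.
have [le|/ltnW le] := leqP (S ord_max ord0) (S ord0 ord_max); [left | right].
  by apply: listed_mx_min => //; move: m_in; rewrite -minE (minn_idPr le).
have r0 : rev_ord (ord0 : 'I_2) = ord_max by apply: val_inj.
have r1 : rev_ord (ord_max : 'I_2) = ord0 by apply: val_inj.
rewrite le /=; apply: listed_mx_min => //; rewrite !mxE ?r0 ?r1.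
- by rewrite addnC.
- by rewrite addnC.
- by rewrite addnC.
- by move: m_in; rewrite -minE (minn_idPl le).
Qed.
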